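(* Let $F$ be a finite field with $|F|=q$, let $n>1$ be an odd integer with $\gcd(n,q)=1$, let $G$ be an abelian group of order $n$, and let $\delta$ be a real number with $0\le\delta\le1-q^{-1}$. Assume that $\frac14-h_q(\delta)-\frac{\log_qn}{2\mu_q(n)}>0$. Then $$\big|\mathcal D^{\le\delta}\big|\le q^{\frac{n-1}2-2\mu_q(n)\left(\frac14-h_q(\delta)-\frac{\log_qn}{\mu_q(n)}\right)+4}.$$
   Context: $FG$ is the group algebra; for $a=\sum_{x\in G}a_xx\in FG$ put $\overline a=\sum_{x\in G}a_xx^{-1}$. Elements of $(FG)^2=FG\times FG$ are identified with words in $F^{2n}$; $\mathrm w(a,b)$ is the Hamming weight of $(a,b)$, and for a nonzero $FG$-submodule $C\le(FG)^2$, $\mathrm w(C)$ is the minimum Hamming weight of its nonzero elements. For $b\in FG$, $C_{1,b}=\{(u,ub)\mid u\in FG\}$. Put $\mathcal D=\{C_{1,b}\mid b\in FG,\ b\overline b=-1\}$ and $\mathcal D^{\le\delta}=\{C\in\mathcal D\mid \frac{\mathrm w(C)}{2n}\le\delta\}$. $\mu_q(n)$ is the minimal size of the non-trivial (i.e. $\neq\{0\}$) $q$-cyclotomic cosets of $\mathbb Z/n\mathbb Z$, i.e. orbits of multiplication by $q$. The $q$-entropy function is $h_q(\delta)=\delta\log_q(q-1)-\delta\log_q\delta-(1-\delta)\log_q(1-\delta)$ for $\delta\in[0,1-q^{-1}]$, with $h_q(0)=0$. *)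

(* Defs.v *)
From HB Require Import structures.
From mathcomp Require Import all_boot all_order all_algebra all_fingroup.
From mathcomp Require Import reals exp.

Set Implicit Arguments.
Unset Strict Implicit.
Unset Printing Implicit Defensive.

Import Order.TTheory GRing.Theory Num.Theory.
Local Open Scope ring_scope.

(* The group algebra FG of the whole group gT, an element being its
   coefficient function x |-> a_x.  It is an alias of {ffun gT -> F} because
   the latter already carries the pointwise product. *)
Definition galg (F : finFieldType) (gT : finGroupType) : Type :=
  {ffun gT -> F}.

HB.instance Definition _ (F : finFieldType) (gT : finGroupType) :=
  Finite.copy (galg F gT) {ffun gT -> F}.
HB.instance Definition _ (F : finFieldType) (gT : finGroupType) :=
  GRing.Lmodule.copy (galg F gT) {ffun gT -> F^o}.

Definition coef (F : finFieldType) (gT : finGroupType) (a : galg F gT)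
  (x : gT) : F := (a : {ffun gT -> F}) x.

Definition galg_one (F : finFieldType) (gT : finGroupType) : galg F gT :=
  [ffun x : gT => (x == 1%g)%:R].

Definition galg_mul (F : finFieldType) (gT : finGroupType)
    (a b : galg F gT) : galg F gT :=
  [ffun z : gT => \sum_(x : gT) coef a x * coef b (x^-1 * z)%g].

Lemma galg_mulA (F : finFieldType) (gT : finGroupType) :
  associative (@galg_mul F gT).
Proof.
move=> a b c; apply/ffunP=> z; rewrite !ffunE.
under eq_bigr => x _ do rewrite /coef ffunE mulr_sumr.
under [RHS]eq_bigr => y _ do rewrite /coef ffunE mulr_suml.
rewrite [RHS]exchange_big; apply: eq_bigr => x _ /=.
rewrite [RHS](reindex_inj (mulgI x)); apply: eq_bigr => y _ /=.
by rewrite mulKg invMg mulgA mulrA.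
Qed.

Lemma galg_mul1r (F : finFieldType) (gT : finGroupType) :
  left_id (galg_one F gT) (@galg_mul F gT).
Proof.
move=> a; apply/ffunP=> z; rewrite ffunE (bigD1 1%g) //= big1 ?addr0.
  by rewrite /coef ffunE eqxx mul1r invg1 mul1g.
by move=> x /negbTE nx; rewrite /coef ffunE nx mul0r.
Qed.

Lemma galg_mulr1 (F : finFieldType) (gT : finGroupType) :
  right_id (galg_one F gT) (@galg_mul F gT).
Proof.
move=> a; apply/ffunP=> z; rewrite ffunE (bigD1 z) //= big1 ?addr0.
  by rewrite /coef ffunE mulVg eqxx mulr1.
move=> x nx; rewrite /coef ffunE -eq_mulVg1.
by rewrite (negbTE nx) mulr0.
Qed.

Lemma galg_mulDl (F : finFieldType) (gT : finGroupType) :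
  left_distributive (@galg_mul F gT) +%R.
Proof.
move=> a b c; apply/ffunP=> z; rewrite !ffunE -big_split.
by apply: eq_bigr => x _; rewrite /coef ffunE mulrDl.
Qed.

Lemma galg_mulDr (F : finFieldType) (gT : finGroupType) :
  right_distributive (@galg_mul F gT) +%R.
Proof.
move=> a b c; apply/ffunP=> z; rewrite !ffunE -big_split.
by apply: eq_bigr => x _; rewrite /coef ffunE mulrDr.
Qed.

Lemma galg_one_neq0 (F : finFieldType) (gT : finGroupType) :
  galg_one F gT != 0.
Proof.
by apply/eqP => /ffunP/(_ 1%g)/eqP; rewrite !ffunE eqxx oner_eq0.
Qed.

HB.instance Definition _ (F : finFieldType) (gT : finGroupType) :=
  GRing.Zmodule_isNzRing.Build (galg F gT)
    (@galg_mulA F gT) (@galg_mul1r F gT) (@galg_mulr1 F gT)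
    (@galg_mulDl F gT) (@galg_mulDr F gT) (galg_one_neq0 F gT).

Lemma galg_scaleAl (F : finFieldType) (gT : finGroupType) (k : F)
  (a b : galg F gT) : k *: (a * b) = (k *: a) * b.
Proof.
apply/ffunP=> z; rewrite !ffunE scaler_sumr.
by apply: eq_bigr => x _; rewrite /coef ffunE scalerAl.
Qed.

HB.instance Definition _ (F : finFieldType) (gT : finGroupType) :=
  GRing.Lmodule_isLalgebra.Build F (galg F gT) (@galg_scaleAl F gT).

Lemma galg_scaleAr (F : finFieldType) (gT : finGroupType) (k : F)
  (a b : galg F gT) : k *: (a * b) = a * (k *: b).
Proof.
apply/ffunP=> z; rewrite !ffunE scaler_sumr.
by apply: eq_bigr => x _; rewrite /coef ffunE scalerAr.
Qed.

HB.instance Definition _ (F : finFieldType) (gT : finGroupType) :=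
  GRing.Lalgebra_isAlgebra.Build F (galg F gT) (@galg_scaleAr F gT).

Definition gconj (F : finFieldType) (gT : finGroupType) (a : galg F gT) :
  galg F gT := [ffun x : gT => coef a x^-1%g].

Definition hamming_weight (F : finFieldType) (gT : finGroupType)
    (c : galg F gT * galg F gT) : nat :=
  (#|[set x | coef c.1 x != 0%R]| + #|[set x | coef c.2 x != 0%R]|)%N.

(* The default value 2 * #|gT|, the length of the words, bounds every weight,
   so it does not affect the minimum as soon as C has a nonzero element. *)
Definition min_weight (F : finFieldType) (gT : finGroupType)
    (C : {set galg F gT * galg F gT}) : nat :=
  \big[Order.min/(2 * #|gT|)%N]_(c in C | c != 0) hamming_weight c.

Definition code1 (F : finFieldType) (gT : finGroupType) (b : galg F gT) :
  {set galg F gT * galg F gT} := [set (u, u * b) | u : galg F gT].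

Definition codesD (F : finFieldType) (gT : finGroupType) :
  {set {set galg F gT * galg F gT}} :=
  [set code1 b | b : galg F gT & b * gconj b == -1].

Definition codesD_le (R : realType) (F : finFieldType) (gT : finGroupType)
    (delta : R) : {set {set galg F gT * galg F gT}} :=
  [set C in codesD F gT |
    (min_weight C)%:R / (2 * #|gT|)%N%:R <= delta].

Definition cyclotomic_coset (q n : nat) (x : 'Z_n) : {set 'Z_n} :=
  [set y in fingraph.orbit (fun z : 'Z_n => q%:R * z) x].

Definition cyclotomic_cosets (q n : nat) : {set {set 'Z_n}} :=
  [set cyclotomic_coset q x | x : 'Z_n].

(* Meant for 1 < n, where 'Z_n has n elements: the default value n then bounds
   the size of every coset, and there is a non-trivial coset. *)
Definition mu (q n : nat) : nat :=
  \big[Order.min/n]_(C in cyclotomic_cosets q n | C != [set 0]) #|C|.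

Definition logb (R : realType) (b x : R) : R := ln x / ln b.

Definition qentropy (R : realType) (q : nat) (delta : R) : R :=
  if delta == 0 then 0 else
  delta * logb q%:R (q%:R - 1) - delta * logb q%:R delta
  - (1 - delta) * logb q%:R (1 - delta).

(* Main.v *)
From HB Require Import structures.
Require Import Defs.
From mathcomp Require Import all_boot all_order all_algebra all_fingroup.
From mathcomp Require Import all_solvable all_field.
From mathcomp Require Import reals sequences exp.
From mathcomp Require Import ring lra zify.
Import Order.TTheory GRing.Theory Num.Theory.
Set Implicit Arguments.
Unset Strict Implicit.
Unset Printing Implicit Defensive.
Local Open Scope ring_scope.

(** As gcd(n,q) = 1, a |-> a^(q^phi(n)) is the identity of FG, so FG is a
    product of fields FGe, with e running over the set P of primitive
    idempotents; let N_e = |FGe|.  Unless e is fixed by G, some g e <> e is a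
    root of unity in FGe, whence N_e >= q^mu.

    A light code C_{1,b} contains a light word (u, ub) with u <> 0.  Let S be
    the set of e with ue <> 0.  Some e in S is moved by G, as otherwise u and
    ub would be constant on G and (u, ub) of weight 2n.
    - The light words with this S lie in I x I, I the ideal of the components
      in S, and there are at most (prod_(e in S) N_e)^(2h) of them, because the
      translates of an information set of I cover G evenly.
    - Given (u, ub), b is known on the components in S, and the equation
      b * conj b = -1 leaves at most prod_(e in P - S) (sqrt N_e + 1) choices
      for the others.
    Summing over S expands a product: with eps = 1/4 - h, a_e = N_e^(-2 eps)
    and y_e = N_e^(-1/2) <= a_e, the number of codes is at most q^(n/2) times
    prod_e (a_e + 1 + y_e) - prod_e (a'_e + 1 + y_e), where a' vanishes on the
    moved e.  With x = q^(-2 mu eps), which is at most 1/n by hypothesis, this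
    difference is at most 3 n x (1 + 2x)^n <= 27 n x. *)

(** * Primitive idempotents of a finite reduced commutative ring *)

Section PrimitiveIdempotents.

Variable A : finComNzRingType.

(** Locked so that [inE] does not unfold membership. *)
Definition prim_idem : {set A} := locked
  [set e | [&& e != 0, e * e == e &
    [forall f : A, (f * f == f) ==> (e * f == 0) || (e * f == e)]]].

Definition corner (e : A) : {set A} := locked [set a | a * e == a].

Lemma prim_idemP e :
  reflect [/\ e != 0, e * e = e &
            forall f, f * f = f -> e * f = 0 \/ e * f = e]
          (e \in prim_idem).
Proof.
rewrite /prim_idem -lock inE; apply: (iffP and3P) => [[-> /eqP -> /forallP He]|[-> -> He]].
  split=> // f /eqP ff; have := He f; rewrite ff /= => /orP[] /eqP; auto.
split=> //; apply/forallP => f; apply/implyP => /eqP /He.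
by case=> ->; rewrite eqxx ?orbT.
Qed.

Lemma prim_idem_neq0 e : e \in prim_idem -> e != 0.
Proof. by case/prim_idemP. Qed.

Lemma prim_idem_idem e : e \in prim_idem -> e * e = e.
Proof. by case/prim_idemP. Qed.

Lemma cornerP e a : reflect (a * e = a) (a \in corner e).
Proof. by rewrite /corner -lock inE; apply: eqP. Qed.

Lemma mem_corner e a : e \in prim_idem -> a * e \in corner e.
Proof. by move/prim_idem_idem=> ee; apply/cornerP; rewrite -mulrA ee. Qed.

Lemma corner_id e : e \in prim_idem -> e \in corner e.
Proof. by move/prim_idem_idem=> ee; apply/cornerP. Qed.

Lemma corner0 e : 0 \in corner e.
Proof. by apply/cornerP; rewrite mul0r. Qed.

Lemma cornerD e a b : a \in corner e -> b \in corner e -> a + b \in corner e.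
Proof. by move=> /cornerP ea /cornerP eb; apply/cornerP; rewrite mulrDl ea eb. Qed.

Lemma cornerN e a : a \in corner e -> - a \in corner e.
Proof. by move=> /cornerP ea; apply/cornerP; rewrite mulNr ea. Qed.

Lemma cornerB e a b : a \in corner e -> b \in corner e -> a - b \in corner e.
Proof. by move=> ea eb; rewrite cornerD ?cornerN. Qed.

Lemma cornerMl e a b : b \in corner e -> a * b \in corner e.
Proof. by move=> /cornerP eb; apply/cornerP; rewrite -mulrA eb. Qed.

Lemma prim_idem_orth e f :
  e \in prim_idem -> f \in prim_idem -> e != f -> e * f = 0.
Proof.
move=> /prim_idemP[_ ee He] /prim_idemP[_ ff Hf] /eqP nef.
have [//|ef] := He f ff; have [|fe] := Hf e ee; first by rewrite mulrC.
by case: nef; rewrite -ef mulrC fe.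
Qed.

Lemma sum_idem_mul (S : {set A}) e : S \subset prim_idem -> e \in prim_idem ->
  (\sum_(f in S) f) * e = if e \in S then e else 0.
Proof.
move=> sS Pe; rewrite mulr_suml; case: ifP => eS.
  rewrite (bigD1 e) //= prim_idem_idem // big1 ?addr0 // => f /andP[fS nf].
  exact: prim_idem_orth (subsetP sS f fS) Pe nf.
apply: big1 => f fS; apply: prim_idem_orth (subsetP sS f fS) Pe _.
by apply/eqP => fe; rewrite -fe fS in eS.
Qed.

(** Descent on the size of the ideal Af: if [f] is not primitive, some nonzero idempotent [f * g]
    generates a strictly smaller ideal. *)
Lemma prim_idem_below f : f != 0 -> f * f = f ->
  exists2 e, e \in prim_idem & e * f = e.
Proof.
have [m] := ubnP #|corner f|; elim: m f => // m IH f lem nf ff.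
have [Pf|] := boolP (f \in prim_idem); first by exists f.
rewrite {1}/prim_idem -lock inE nf ff eqxx /= => /forallPn[g].
rewrite negb_imply negb_or => /and3P[/eqP gg nfg nfgf].
have sub : corner (f * g) \proper corner f.
  apply/properP; split.
    apply/subsetP => a /cornerP ea; apply/cornerP.
    by rewrite -ea -!mulrA (mulrC g f) (mulrA f) ff.
  exists f; first by apply/cornerP.
  by apply/negP => /cornerP; rewrite mulrA ff => /eqP; rewrite (negbTE nfgf).
have [||e Pe efg] := IH (f * g) _ nfg.
- exact: leq_trans (proper_card sub) lem.
- by rewrite mulrACA ff gg.
by exists e => //; rewrite -efg -!mulrA (mulrC g) (mulrA f) ff.
Qed.

(** Otherwise a primitive [e] lies below the idempotent [1 - s], although [s * e = e] forces
    [e * (1 - s) = 0]. *)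
Lemma sum_prim_idem : \sum_(e in prim_idem) e = 1.
Proof.
set s := \sum_(e in _) e.
have se e : e \in prim_idem -> s * e = e.
  by move=> Pe; rewrite sum_idem_mul ?Pe.
have ss : s * s = s by rewrite {2}/s mulr_sumr; apply: eq_bigr.
have [/eqP|ns] := eqVneq (1 - s) 0; first by rewrite subr_eq0 => /eqP.
have [|e Pe] := prim_idem_below ns; first by ring: ss.
by rewrite mulrBr mulr1 mulrC se // subrr => /esym/eqP; 
   rewrite (negbTE (prim_idem_neq0 Pe)).
Qed.

Lemma eq_prim_idem a b : (forall e, e \in prim_idem -> a * e = b * e) -> a = b.
Proof.
move=> ab; rewrite -(mulr1 a) -(mulr1 b) -sum_prim_idem !mulr_sumr.
exact: eq_bigr.
Qed.

Lemma card_corner_gt0 e : (0 < #|corner e|)%N.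
Proof. by apply/card_gt0P; exists 0; exact: corner0. Qed.

(** Taken at [prim_idem :\: S], this is the sum of the components belonging to [S]. *)
Definition vanish (S : {set A}) : {set A} := [set a | [forall e in S, a * e == 0]].

Lemma card_vanish (S : {set A}) :
  (#|vanish (prim_idem :\: S)| <= \prod_(e in S) #|corner e|)%N.
Proof.
have <- : #|[set h in pfamily 0 S (fun e => mem (corner e))]|
    = (\prod_(e in S) #|corner e|)%N.
  by rewrite cardsE card_pfamily foldrE big_map big_enum.
(* [S] may contain elements that are not primitive; their coordinates are set to 0. *)
pose U := S :&: prim_idem.
have fin (a : A) : [ffun e => if e \in U then a * e else 0] 
    \in pfamily 0 S (fun e => mem (corner e)).
  apply/pfamilyP; split.
    apply/supportP => e nS; rewrite ffunE inE (negbTE nS) /=; reflexivity.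
  move=> e eS; rewrite ffunE; case: ifP => [|_]; last exact: corner0.
  by case/setIP => _; apply: mem_corner.
set V := vanish _.
rewrite -(@card_in_imset _ _
   (fun a : A => [ffun e => if e \in U then a * e else 0]) V).
  by apply: subset_leq_card; apply/subsetP => _ /imsetP[a _ ->]; rewrite inE.
move=> a b; rewrite !inE => /forall_inP Va /forall_inP Vb /ffunP ab.
apply: eq_prim_idem => e Pe; have [eS|nS] := boolP (e \in S).
  by have := ab e; rewrite !ffunE inE eS Pe.
have eV : e \in prim_idem :\: S by rewrite inE nS.
by rewrite (eqP (Va e eV)) (eqP (Vb e eV)).
Qed.

(** By orthogonality, multiplying a sum of components by [e] recovers the one at [e], so summation
    is injective on families. *)
Lemma prod_card_corner : (\prod_(e in prim_idem) #|corner e| <= #|A|)%N.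
Proof.
have <- : #|[set h in pfamily 0 prim_idem (fun e => mem (corner e))]|
    = (\prod_(e in prim_idem) #|corner e|)%N.
  by rewrite cardsE card_pfamily foldrE big_map big_enum.
rewrite -(@card_in_imset _ _ (fun h : {ffun A -> A} => 
  \sum_(e in prim_idem) h e)); first exact: max_card.
have sumE h e : h \in pfamily 0 prim_idem (fun e => mem (corner e)) -> 
    e \in prim_idem -> (\sum_(f in prim_idem) h f) * e = h e.
  move=> /pfamilyP[_ hP] Pe; rewrite mulr_suml (bigD1 e) //=.
  rewrite (cornerP _ _ (hP e Pe)) big1 ?addr0 // => f /andP[Pf nf].
  by rewrite -(cornerP _ _ (hP f Pf)) -mulrA (prim_idem_orth Pf Pe nf) mulr0.
move=> h k; rewrite !in_set => hP kP hk; apply/ffunP => e.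
have [Pe|nP] := boolP (e \in prim_idem).
  by rewrite -(sumE h e) // -(sumE k e) // hk.
have /pfamilyP[/supportP-/(_ e nP) h0 _] := hP.
have /pfamilyP[/supportP-/(_ e nP) k0 _] := kP.
by rewrite h0 k0.
Qed.

(* The hypothesis says that A is a product of finite fields K with |K| - 1
   dividing Q + 1. *)
Variable Q : nat.
Hypothesis AQ : forall a : A, a ^+ Q.+2 = a.

(** [u ^+ Q.+1] is idempotent, so its product with [e] is 0 or [e]; the former would give
    [u = u ^+ Q.+2 = 0], and in the latter case [u ^+ Q * e] is the inverse. *)
Lemma prim_idem_inv e u : e \in prim_idem -> u \in corner e -> u != 0 ->
  exists2 v, v \in corner e & u * v = e.
Proof.
move=> Pe /cornerP ue nu; have [_ ee He] := prim_idemP _ Pe.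
have idem : u ^+ Q.+1 * u ^+ Q.+1 = u ^+ Q.+1.
  by rewrite -[X in X * _]mul1r -mulrA -exprD addSnnS exprD AQ mul1r -exprSr.
exists (u ^+ Q * e); first exact: mem_corner.
have [eu0|] := He _ idem; last by rewrite mulrA -exprS mulrC.
by case/eqP: nu; rewrite -[LHS]AQ exprS -[X in X * _]ue -mulrA eu0 mulr0.
Qed.

Lemma prim_idem_integral e u v : e \in prim_idem ->
  u \in corner e -> v \in corner e -> u * v = 0 -> u = 0 \/ v = 0.
Proof.
move=> Pe ue ve uv0; have [->|nu] := eqVneq u 0; [by left|right].
have [w we uw] := prim_idem_inv Pe ue nu.
by rewrite -(cornerP _ _ ve) -uw mulrA (mulrC v) uv0 mul0r.
Qed.

Lemma prim_idem_cancel e u v w : e \in prim_idem ->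
  u \in corner e -> v \in corner e -> w \in corner e -> w != 0 ->
  u * w = v * w -> u = v.
Proof.
move=> Pe ue ve we nw uvw; apply/eqP; rewrite -subr_eq0.
have [|/eqP //|w0] := prim_idem_integral Pe (cornerB ue ve) we.
  by rewrite mulrBl uvw subrr.
by rewrite w0 eqxx in nw.
Qed.

Lemma card_corner_gt1 e : e \in prim_idem -> (1 < #|corner e|)%N.
Proof.
move=> Pe; rewrite (cardD1 0) corner0 (cardD1 e) !inE prim_idem_neq0 //=.
by rewrite corner_id.
Qed.

(** Multiplication by [u] permutes the nonzero elements of the component, so [u ^+ #|U|] fixes their
    product, whose image in the component is invertible. *)
Lemma expr_card_corner e u : e \in prim_idem -> u \in corner e -> u != 0 ->
  u ^+ #|corner e|.-1 * e = e.
Proof.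
move=> Pe ue nu; set U := corner e :\ 0.
have cU : #|U| = #|corner e|.-1 by rewrite (cardsD1 0 (corner e)) corner0.
have memU v : v \in U -> v \in corner e by rewrite !inE => /andP[].
have inU v : v \in U -> u * v \in U.
  rewrite in_setD1 => /andP[nv ve]; rewrite in_setD1 cornerMl // andbT.
  apply/eqP => /(prim_idem_integral Pe ue ve)[] /eqP.
    by rewrite (negbTE nu).
  by rewrite (negbTE nv).
have injU : {in U &, injective (fun v => u * v)}.
  move=> v w /memU ve /memU we; rewrite mulrC (mulrC u).
  exact: prim_idem_cancel ue nu.
have imU : [set u * v | v in U] = U.
  apply/eqP; rewrite eqEcard (card_in_imset injU) leqnn andbT.
  by apply/subsetP => _ /imsetP[v vU ->]; apply: inU.
pose p := \prod_(v in U) v.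
have pE : u ^+ #|U| * p = p.
  by rewrite -prodr_const -big_split /p /= -[in RHS]imU big_imset.
have [w pw] : exists w, p * e * w = e.
  rewrite /p; elim/big_rec: _ => [|v x vU [w xw]].
    by exists e; rewrite mul1r prim_idem_idem.
  move: vU; rewrite in_setD1 => /andP[nv ve].
  have [v' _ vv'] := prim_idem_inv Pe ve nv.
  exists (w * v'); rewrite -{2}vv' -[in RHS](cornerP _ _ ve) -{2}xw; ring.
by rewrite -cU -pw -!mulrA mulrA pE.
Qed.

(** * An involution permutes the components *)

Section Involution.

Variable s : {rmorphism A -> A}.
Hypothesis sK : involutive s.

Lemma prim_idem_conj e : e \in prim_idem -> s e \in prim_idem.
Proof.
move=> /prim_idemP[ne ee He]; apply/prim_idemP; split.
- by apply: contra ne => /eqP se; rewrite -(sK e) se rmorph0.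
- by rewrite -rmorphM ee.
move=> f ff; have [|ef|ef] := He (s f); first by rewrite -rmorphM ff.
  by left; rewrite -(sK f) -rmorphM ef rmorph0.
by right; rewrite -{1}(sK f) -rmorphM ef.
Qed.

Lemma mem_corner_conj e u : u \in corner e -> s u \in corner (s e).
Proof. by move/cornerP=> ue; apply/cornerP; rewrite -rmorphM ue. Qed.

Lemma card_corner_conj e : #|corner (s e)| = #|corner e|.
Proof.
rewrite -(card_imset (corner e) (inv_inj sK)).
apply: eq_card => u; apply/idP/imsetP => [ue|[v ve ->]].
  by exists (s u); rewrite ?sK // -(sK e) mem_corner_conj.
exact: mem_corner_conj.
Qed.

End Involution.
End PrimitiveIdempotents.

(** * The equation b * s b = -1 for an involution s *)

Section NormEquation.

Variables (A : finComNzRingType) (Q : nat) (s : {rmorphism A -> A}).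
Hypothesis AQ : forall a : A, a ^+ Q.+2 = a.
Hypothesis sK : involutive s.

Definition norm_fiber (e c : A) : {set A} := [set u in corner e | u * s u == c].

(** * Norm equation in a component stable under the involution *)

Section FixedIdempotent.

Variable e : A.
Hypotheses (Pe : e \in prim_idem A) (se : s e = e).

Let ee : e * e = e. Proof. exact: prim_idem_idem. Qed.

Let se_corner u : u \in corner e -> s u \in corner e.
Proof. by move/(mem_corner_conj s); rewrite se. Qed.

Let sym : {set A} := [set u in corner e | s u == u].

Let symP u : reflect (u \in corner e /\ s u = u) (u \in sym).
Proof.
by rewrite inE; apply: (iffP andP) => -[? /eqP].
Qed.

(** The equation becomes u^2 = c, and two solutions satisfy (v - u)(v + u) = 0. *)
Lemma card_norm_fiber_sym c : (forall u, u \in corner e -> s u = u) ->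
  (#|norm_fiber e c| <= 2)%N.
Proof.
move=> triv; have [->|[u]] := set_0Vmem (norm_fiber e c); first by rewrite cards0.
rewrite inE => /andP[ue /eqP uc].
apply: leq_trans (_ : #|[set u; - u]| <= 2)%N; last by rewrite cards2; case: eqP.
apply: subset_leq_card; apply/subsetP => v; rewrite !inE => /andP[ve /eqP vc].
rewrite -addr_eq0 -subr_eq0; apply/orP.
have [|h|h] := prim_idem_integral AQ Pe (cornerB ve ue) (cornerD ve ue).
- by rewrite -subr_sqr !expr2 -{2}(triv v ve) vc -{2}(triv u ue) uc subrr.
- by rewrite h eqxx; left.
by rewrite h eqxx; right.
Qed.

Variable t : A.
Hypotheses (te : t \in corner e) (nt : s t != t).

Let nst : t - s t != 0. Proof. by rewrite subr_eq0 eq_sym. Qed.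

Lemma card_fixed_sqr : (#|sym| ^ 2 = #|corner e|)%N.
Proof.
apply/eqP; rewrite eqn_leq -mulnn -cardsX; apply/andP; split.
  (* [e] and [t] are linearly independent over the fixed field [sym]. *)
  pose f (xy : A * A) := xy.1 + xy.2 * t.
  rewrite -(@card_in_imset _ _ f (setX sym sym)).
    apply: subset_leq_card; apply/subsetP => _ /imsetP[[x y] + ->].
    rewrite in_setX /= => /andP[/symP[xe _] /symP[ye _]].
    by rewrite cornerD // cornerMl.
  move=> [x y] [x' y'] /[!in_setX]/= /andP[/symP[xe sx] /symP[ye sy]].
  move=> /andP[/symP[xe' sx'] /symP[ye' sy']]; rewrite /f /= => xy.
  have yt : (y - y') * (t - s t) = 0.
    have /(congr1 s) := xy; rewrite !rmorphD !rmorphM sx sy sx' sy' => sxy.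
    have -> : (y - y') * (t - s t) = 
      (x + y * t - (x' + y' * t)) - (x + y * s t - (x' + y' * s t)) by ring.
    by rewrite xy sxy !subrr.
  have yy : y = y'.
    have [||/eqP|/eqP] := prim_idem_integral AQ Pe _ _ yt.
    - exact: cornerB.
    - exact/cornerB/se_corner.
    - by rewrite subr_eq0 => /eqP.
    by rewrite (negbTE nst).
  by move: xy; rewrite yy => /addIr ->.
(* The traces of [y] and [y * t] determine [y]: up to sign, the determinant of the system is
   [t - s t]. *)
pose f (y : A) := (y + s y, y * t + s (y * t)).
rewrite -(@card_in_imset _ _ f (corner e)).
  apply: subset_leq_card; apply/subsetP => _ /imsetP[y ye ->].
  have fix_tr z : z \in corner e -> z + s z \in sym.
    move=> ze; apply/symP; split; first by rewrite cornerD ?se_corner.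
    by rewrite rmorphD sK addrC.
  by rewrite in_setX /= !fix_tr ?cornerMl.
move=> y y' ye ye' [h1 h2].
have [|||/eqP|/eqP] := prim_idem_integral AQ Pe (u := y - y') (v := t - s t).
- exact: cornerB.
- exact/cornerB/se_corner.
- have -> : (y - y') * (t - s t) = (y * t + s y * s t) - (y' * t + s y' * s t)
     - s t * ((y + s y) - (y' + s y')) by ring.
  by rewrite -!rmorphM h1 h2 !subrr mulr0 subrr.
- by rewrite subr_eq0 => /eqP.
by rewrite (negbTE nst).
Qed.

(* By Hilbert 90 the solutions v of v * s v = e are the slopes of the
   |sym| + 1 lines of the plane [corner e] over the field [sym]; here only
   that every slope v is attained, by the vector w v, is used. *)
Lemma card_norm_one : (#|norm_fiber e e| <= #|sym|.+1)%N.
Proof.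
(* [e + v] solves w = v * s w because [v * s v = e]; it vanishes only for [v = - e], where the
   antisymmetric [t - s t] serves instead. *)
pose w v := if e + v == 0 then t - s t else e + v.
have wP v : v \in norm_fiber e e -> [/\ w v \in corner e, w v != 0 & 
    w v = v * s (w v)].
  rewrite inE => /andP[ve /eqP vv]; rewrite /w; case: eqP => [/eqP|/eqP nv].
    rewrite addrC addr_eq0 => /eqP ->; split=> //.
      exact/cornerB/se_corner.
    rewrite rmorphB sK mulNr -mulrN opprB mulrBr !(mulrC e).
    by rewrite (cornerP _ _ te) (cornerP _ _ (se_corner te)).
  split=> //; first by rewrite cornerD ?corner_id.
  by rewrite rmorphD se mulrDr vv (cornerP _ _ ve) addrC.
pose f (vx : A * A) := vx.2 * w vx.1.
have nz x v : x \in sym :\ 0 -> v \in norm_fiber e e -> x * w v != 0.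
  rewrite in_setD1 => /andP[nx /symP[xe _]] /wP[we nw _].
  apply/eqP => /(prim_idem_integral AQ Pe xe we)[] /eqP.
    by rewrite (negbTE nx).
  by rewrite (negbTE nw).
(* The point [x * w v] is [v] times its own conjugate, hence determines [v], and then [x]. *)
have injf : {in setX (norm_fiber e e) (sym :\ 0) &, injective f}.
  move=> [v x] [v' x'] /[!in_setX]/= /andP[vN xS] /andP[vN' xS'].
  rewrite /f /= => xv; have nxv := nz _ _ xS vN.
  have [we nw wv] := wP _ vN; have [we' nw' wv'] := wP _ vN'.
  move: (xS) (xS'); rewrite !in_setD1 => /andP[_ /symP[xe sx]] /andP[_ /symP[xe' sx']].
  have vv : v = v'.
    apply: (prim_idem_cancel AQ Pe (w := s (x * w v))).
    - by move: vN; rewrite inE => /andP[].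
    - by move: vN'; rewrite inE => /andP[].
    - by rewrite se_corner // cornerMl.
    - by apply: contra nxv => /eqP h; rewrite -(sK (x * w v)) h rmorph0.
    rewrite {2}xv !rmorphM sx sx' mulrCA -wv mulrCA -wv'; exact: xv.
  by move: xv; rewrite -vv => /(prim_idem_cancel AQ Pe xe xe' we nw) ->.
pose S0 := sym :\ 0; pose C0 := corner e :\ 0.
have lines : (#|norm_fiber e e| * #|S0| <= #|C0|)%N.
  rewrite -cardsX -(card_in_imset injf); apply: subset_leq_card.
  apply/subsetP => _ /imsetP[[v x] + ->]; rewrite in_setX /= => /andP[vN xS].
  by rewrite in_setD1 nz // cornerMl //; have [] := wP _ vN.
have s0 : 0 \in sym by apply/symP; rewrite corner0 rmorph0.
have s1 : e \in sym by apply/symP; rewrite corner_id.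
have S0_gt0 : (0 < #|S0|)%N.
  by apply/card_gt0P; exists e; rewrite in_setD1 s1 prim_idem_neq0.
have := cardsD1 0 sym; have := cardsD1 0 (corner e); rewrite s0 corner0 /=.
rewrite -card_fixed_sqr -/S0 -/C0 => cC cS.
(* With a = |sym| - 1, the nonzero elements of the component number (a + 1)^2 - 1 = (a + 2) a. *)
rewrite -(leq_pmul2r S0_gt0); apply: leq_trans lines _.
by move: cC; rewrite cS -mulnn; set a := #|S0|; set b := #|C0|; lia.
Qed.

(** Multiplication by [s u], for one solution [u], carries the solutions injectively to elements of
    norm [e]. *)
Lemma card_norm_fiber_opp : (#|norm_fiber e (- e)| <= #|sym|.+1)%N.
Proof.
have [->|[u]] := set_0Vmem (norm_fiber e (- e)); first by rewrite cards0.
rewrite inE => /andP[ue /eqP uN]; apply: leq_trans card_norm_one.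
have nu : s u != 0.
  apply/eqP => u0; move/eqP: uN.
  by rewrite u0 mulr0 eq_sym oppr_eq0 (negbTE (prim_idem_neq0 Pe)).
rewrite -(@card_in_imset _ _ (fun v => v * s u) (norm_fiber e (- e))).
  apply: subset_leq_card; apply/subsetP => _ /imsetP[v + ->].
  rewrite inE => /andP[ve /eqP vN]; rewrite inE cornerMl ?se_corner //=.
  by rewrite rmorphM sK mulrACA vN (mulrC (s u)) uN mulrNN ee.
move=> v v'; rewrite inE => /andP[ve _]; rewrite inE => /andP[ve' _].
exact: (prim_idem_cancel AQ Pe ve ve' (se_corner ue) nu).
Qed.

End FixedIdempotent.

Variable R : rcfType.

(** If [s] is nontrivial on the component, the square root is the order of the fixed field;
    otherwise there are at most two solutions, and the bound is at least 2. *)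
Lemma norm_fiber_bound e : e \in prim_idem A -> s e = e ->
  #|norm_fiber e (- e)|%:R <= Num.sqrt #|corner e|%:R + 1 :> R.
Proof.
move=> Pe se; have [/forall_inP triv|] := boolP [forall u in corner e, s u == u].
  apply: (@le_trans _ _ 2).
    by rewrite ler_nat card_norm_fiber_sym // => u /triv /eqP.
  rewrite (_ : 2 = 1 + 1) // lerD2r -[leLHS]sqrtr1 ler_wsqrtr // ler1n.
  exact: card_corner_gt0.
rewrite negb_forall_in => /exists_inP[t te nt].
rewrite -(card_fixed_sqr Pe se te nt) natrX sqrtr_sqr ger0_norm // natr1 ler_nat.
exact: card_norm_fiber_opp te nt.
Qed.

(* Induction on U: in a component e fixed by s the equation leaves
   sqrt |corner e| + 1 choices, while for e <> s e the component at e
   determines the one at s e. *)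
Lemma card_norm_solutions (U X : {set A}) : U \subset prim_idem A ->
  (forall b, b \in X -> b * s b = -1) ->
  (forall b c e, b \in X -> c \in X -> e \in prim_idem A :\: U ->
     b * e = c * e) ->
  #|X|%:R <= \prod_(e in U) (Num.sqrt #|corner e|%:R + 1) :> R.
Proof.
have [m] := ubnP #|U|; elim: m U X => // m IH U X lem sU normX agree.
have sq0 (e : A) : 0 <= Num.sqrt #|corner e|%:R :> R by rewrite sqrtr_ge0.
have [U0|[e eU]] := set_0Vmem U.
  rewrite U0 big_set0 (ler_nat _ _ 1); apply/card_le1_eqP => b c bX cX.
  by apply: eq_prim_idem => e Pe; apply: agree; rewrite // U0 setD0.
have Pe := subsetP sU e eU.
have cUe : (#|U :\ e| < m)%N by move: lem; rewrite (cardsD1 e U) eU.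
have sUe : U :\ e \subset prim_idem A := subset_trans (subsetDl _ _) sU.
(* [X] is grouped by the component at [e], and the induction hypothesis bounds each group. *)
have split (V : {set A}) : V \subset U :\ e ->
  (forall b c f, b \in X -> c \in X -> b * e = c * e -> 
     f \in U :\: V -> b * f = c * f) ->
  #|X|%:R <= #|[set b * e | b in X]|%:R * 
     \prod_(f in V) (Num.sqrt #|corner f|%:R + 1) :> R.
  move=> sV agreeV; rewrite -sum1_card (partition_big_imset (fun b => b * e)) /=.
  rewrite natr_sum mulr_natl -sumr_const; apply: ler_sum => _ /imsetP[b bX ->].
  pose fib : {set A} := [set c in X | c * e == b * e].
  rewrite (_ : \sum_(i in X | _) 1 = #|fib|)%N; last first.
    by rewrite -sum1_card; apply: eq_bigl => c; rewrite inE.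
  apply: IH.
  - exact: leq_ltn_trans (subset_leq_card sV) cUe.
  - exact: subset_trans sUe.
  - by move=> c; rewrite inE => /andP[/normX].
  move=> c d f; rewrite !inE => /andP[cX /eqP ce] /andP[dX /eqP de] /andP[nf Pf].
  have [fU|nU] := boolP (f \in U).
    by apply: agreeV; rewrite // ?ce ?de // inE nf.
  by apply: agree; rewrite // inE nU.
have le1 (f : A) : 1 <= Num.sqrt #|corner f|%:R + 1 :> R by rewrite lerDr.
have prod_ge0 (V : {set A}) :
    0 <= \prod_(f in V) (Num.sqrt #|corner f|%:R + 1) :> R.
  by apply: prodr_ge0 => f _; rewrite addr_ge0.
(* By the equation, the component at [s e] is minus the inverse of the conjugate of the one at
   [e]. *)
have inve b c : b \in X -> c \in X -> b * e = c * e -> b * s e = c * s e.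
  move=> bX cX bce; have /(congr1 s) := bce; rewrite !rmorphM => sbc.
  have -> : b * s e = - (b * (c * s c * s e)) by rewrite normX // mulN1r mulrN opprK.
  rewrite -mulrA -sbc [X in - X](_ : _ = c * (b * s b * s e)); last by ring.
  by rewrite normX // mulN1r mulrN opprK.
have [se|nse] := eqVneq (s e) e.
  apply: le_trans (split (U :\ e) _ _) _ => //.
    move=> b c f _ _ bce; rewrite !inE => /andP[+ fU].
    by rewrite fU andbT negbK => /eqP ->.
  rewrite [leRHS](big_setD1 e) //= ler_wpM2r //.
  apply: le_trans (norm_fiber_bound Pe se); rewrite ler_nat subset_leq_card //.
  apply/subsetP => _ /imsetP[b bX ->]; rewrite inE mem_corner //=.
  by rewrite rmorphM se mulrACA normX // prim_idem_idem // mulN1r.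
(* If [s e] is in [U], the at most |corner e| choices at [e] settle [s e] too, and |corner e| is the
   product of the two square roots. *)
have [seU|nsU] := boolP (s e \in U).
  apply: le_trans (split (U :\ e :\ s e) _ _) _ => //.
  - exact: subsetDl.
  - move=> b c f bX cX bce; rewrite !inE => /andP[+ fU]; rewrite fU andbT.
    by rewrite negb_and !negbK => /orP[] /eqP -> //; apply: inve.
  rewrite [leRHS](big_setD1 e) //= [in leRHS](big_setD1 (s e)) /=; last first.
    by rewrite !inE nse.
  rewrite mulrA ler_wpM2r // card_corner_conj //.
  apply: (@le_trans _ _ #|corner e|%:R).
    rewrite ler_nat subset_leq_card //.
    by apply/subsetP => _ /imsetP[b bX ->]; rewrite mem_corner.
  have {1}<- : Num.sqrt #|corner e|%:R * Num.sqrt #|corner e|%:R = #|corner e|%:R :> R.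
    by rewrite -expr2 sqr_sqrtr.
  by rewrite ler_pM // lerDl.
(* Here the component at [s e] is already prescribed, so the one at [e] costs only a factor 1. *)
have agreeE b c : b \in X -> c \in X -> b * e = c * e.
  move=> bX cX; have sse : s (s e) = e by rewrite sK.
  have h : b * s e = c * s e.
    by apply: agree; rewrite // inE nsU prim_idem_conj.
  have /(congr1 s) := h; rewrite !rmorphM sse => sbc.
  have -> : b * e = - (b * (c * s c * e)) by rewrite normX // mulN1r mulrN opprK.
  rewrite -mulrA -sbc [X in - X](_ : _ = c * (b * s b * e)); last by ring.
  by rewrite normX // mulN1r mulrN opprK.
rewrite (big_setD1 e) //= -[leLHS]mul1r ler_pM //.
apply: IH => // b c f bX cX; rewrite !inE negb_and negbK.
move=> /andP[/orP[/eqP ->|nf] Pf]; first exact: agreeE.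
by apply: agree => //; rewrite inE nf.
Qed.

End NormEquation.

(** * Abelian group algebras *)

(* An alias carrying the commutativity of the group, so that the group algebra
   becomes a commutative ring. *)
Definition cgalg (F : finFieldType) (gT : finGroupType)
  (cG : abelian [set: gT]) : Type := galg F gT.

HB.instance Definition _ (F : finFieldType) (gT : finGroupType)
    (cG : abelian [set: gT]) :=
  Finite.copy (cgalg F cG) (galg F gT).
HB.instance Definition _ (F : finFieldType) (gT : finGroupType)
    (cG : abelian [set: gT]) :=
  GRing.Algebra.copy (cgalg F cG) (galg F gT).

Section CommutativeGroupAlgebra.

Variables (F : finFieldType) (gT : finGroupType) (cG : abelian [set: gT]).

Let commT (x y : gT) : (x * y = y * x)%g.
Proof. by apply: (centsP cG); rewrite inE. Qed.

Lemma cgalg_mulC : commutative (@galg_mul F gT).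
Proof.
move=> a b; apply/ffunP => z; rewrite !ffunE.
rewrite (reindex_inj (inj_comp (mulgI z) invg_inj)) /=.
apply: eq_bigr => x _.
by rewrite mulrC invMg invgK mulgKV (commT z).
Qed.
End CommutativeGroupAlgebra.

HB.instance Definition _ (F : finFieldType) (gT : finGroupType)
    (cG : abelian [set: gT]) :=
  GRing.PzRing_hasCommutativeMul.Build (cgalg F cG) (cgalg_mulC cG).


Section CommutativeGroupAlgebra.

Variables (F : finFieldType) (gT : finGroupType) (cG : abelian [set: gT]).
Let A : finComNzRingType := cgalg F cG.
Let q := #|F|.
Let n := #|gT|.

Definition delta (g : gT) : galg F gT := [ffun x => (x == g)%:R].

Lemma coef_delta_mul g (a : galg F gT) x :
  coef (delta g * a) x = coef a (g^-1 * x)%g.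
Proof.
rewrite /coef ffunE (bigD1 g) //= big1 ?addr0.
  by rewrite /coef ffunE eqxx mul1r.
by move=> y /negbTE ng; rewrite /coef ffunE ng mul0r.
Qed.

Lemma galg_ext (a b : galg F gT) : (forall x, coef a x = coef b x) -> a = b.
Proof. by move=> ab; apply/ffunP. Qed.

Lemma gcoefD (a b : galg F gT) x : coef (a + b) x = coef a x + coef b x.
Proof. by rewrite /coef ffunE. Qed.

Lemma gcoefZ k (a : galg F gT) x : coef (k *: a) x = k * coef a x.
Proof. by rewrite /coef ffunE. Qed.

Lemma gcoef0 x : coef (0 : galg F gT) x = 0.
Proof. by rewrite /coef ffunE. Qed.

Lemma gcoef_sum (I : Type) (r : seq I) (P : pred I) (a : I -> galg F gT) x :
  coef (\sum_(i <- r | P i) a i) x = \sum_(i <- r | P i) coef (a i) x.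
Proof.
elim/big_rec2: _ => [|i y z _ <-]; first exact: gcoef0.
by rewrite gcoefD.
Qed.

Lemma coef_delta g x : coef (delta g) x = (x == g)%:R.
Proof. by rewrite /coef ffunE. Qed.

Lemma delta1 : delta 1%g = 1.
Proof. by []. Qed.

Lemma deltaM g h : delta g * delta h = delta (g * h)%g.
Proof.
apply: galg_ext => x; rewrite coef_delta_mul !coef_delta; congr (_%:R).
by rewrite -(inj_eq (mulgI g)) mulKVg.
Qed.

Lemma deltaX g k : delta g ^+ k = delta (g ^+ k)%g.
Proof.
elim: k => [|k IH]; first by rewrite expr0 expg0 delta1.
by rewrite exprS IH deltaM expgS.
Qed.

Lemma galg_sum_delta (a : galg F gT) : a = \sum_x coef a x *: delta x.
Proof.
apply: galg_ext => y; rewrite gcoef_sum (bigD1 y) //= big1 ?addr0.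
  by rewrite gcoefZ coef_delta eqxx mulr1.
by move=> x /negbTE nx; rewrite gcoefZ coef_delta eq_sym nx mulr0.
Qed.

Lemma pchar_cgalg : [pchar A].-nat q.
Proof.
have [p p_pr pF] := finPcharP F.
have pA : p \in [pchar A].
  rewrite inE p_pr /=; apply/eqP.
  have -> : (p%:R : A) = (p%:R : F) *: (1 : galg F gT).
    by rewrite scaler_nat.
  by rewrite (pcharf0 pF) scale0r.
rewrite (eq_pnat _ (pcharf_eq pA)) /q -cardsT.
exact: abelem_pgroup (fin_ring_pchar_abelem pF).
Qed.

Lemma cgalg_exprD (a b : A) k : (a + b) ^+ (q ^ k) = a ^+ (q ^ k) + b ^+ (q ^ k).
Proof. by rewrite exprDn_pchar // pnatX pchar_cgalg. Qed.

Lemma expf_card_pow (c : F) k : c ^+ (q ^ k) = c.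
Proof. by elim: k => [|k IH]; rewrite ?expn0 ?expr1 // expnS exprM expf_card. Qed.

(** The map is additive and fixes scalars; it fixes group elements because q^phi(n) is 1 modulo n,
    hence modulo their orders. *)
Lemma cgalg_frobenius_id (a : A) : coprime n q -> a ^+ (q ^ totient n) = a.
Proof.
move=> cnq; set m := (q ^ totient n)%N.
have m_gt0 : (0 < m)%N by rewrite expn_gt0 (ltnW (finNzRing_gt1 F)).
have expr0m : (0 : A) ^+ m = 0 by rewrite expr0n eqn0Ngt m_gt0.
have -> : a = \sum_x coef a x *: delta x :> A by exact: galg_sum_delta.
rewrite (big_morph (fun b : A => b ^+ m) (id1 := 0) (op1 := +%R)) //; last first.
  by move=> b c; apply: cgalg_exprD.
apply: eq_bigr => x _.
transitivity ((coef a x *: delta x : galg F gT) ^+ m); first by [].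
rewrite exprZn expf_card_pow deltaX; congr (_ *: delta _).
rewrite -[RHS]expg1; apply/eqP; rewrite eq_expg_mod_order.
have dx : (#[x]%g %| n)%N by rewrite /n -cardsT order_dvdG ?inE.
rewrite -(modn_dvdm _ dx) -[X in _ == X](modn_dvdm _ dx).
by apply/eqP; congr modn; rewrite Euler_exp_totient // coprime_sym.
Qed.

End CommutativeGroupAlgebra.

(** * Cyclotomic cosets *)

Lemma card_orbit_le (T : finType) (f : T -> T) x d :
  (0 < d)%N -> iter d f x = x -> (#|[set y in fingraph.orbit f x]| <= d)%N.
Proof.
move=> d_gt0 fx; rewrite cardsE (card_uniqP (orbit_uniq f x)) size_orbit leqNgt.
apply/negP => /findex_iter; rewrite fx findex0 => d0.
by rewrite -d0 in d_gt0.
Qed.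

Lemma mu_gt0 q n : (0 < n)%N -> (0 < mu q n)%N.
Proof.
move=> n_gt0; apply: (big_ind (fun m => 0 < m)%N) => //.
  by move=> x y x0 y0; rewrite /Order.min; case: ifP.
move=> _ /andP[/imsetP[x _ ->] _]; apply/card_gt0P; exists x.
by rewrite inE in_orbit.
Qed.

(** The residue n/m is nonzero and n divides (q^d - 1) n/m, so the coset of n/m is non-trivial with
    at most d elements. *)
Lemma mu_le q n d m : (1 < n)%N -> (0 < d)%N -> (1 < m)%N -> (m %| n)%N ->
  (m %| q ^ d - 1)%N -> (0 < q)%N -> (mu q n <= d)%N.
Proof.
move=> n_gt1 d_gt0 m_gt1 mn mq q_gt0; pose x : 'Z_n := (n %/ m)%:R.
have nm_gt0 : (0 < n %/ m)%N by rewrite divn_gt0 ?(ltnW m_gt1) // dvdn_leq // ltnW.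
have valx : nat_of_ord x = (n %/ m)%N.
  by rewrite /x val_Zp_nat // modn_small // ltn_Pdiv // ltnW.
have xq : iter d (fun z : 'Z_n => q%:R * z) x = x.
  have -> : iter d (fun z : 'Z_n => q%:R * z) x = (q ^ d)%:R * x.
    elim: (d) => [|k /= ->]; first by rewrite expn0 mul1r.
    by rewrite mulrA -natrM expnS.
  apply/eqP; rewrite -subr_eq0 -[X in _ - X]mul1r -mulrBl.
  rewrite -(natrB _ (_ : 1 <= q ^ d)%N) ?expn_gt0 ?q_gt0 // -natrM.
  have [k ->] := dvdnP mq; rewrite -mulnA (mulnC m) divnK // mulnC natrM.
  by rewrite pchar_Zp // mul0r.
apply: leq_trans (card_orbit_le d_gt0 xq).
apply: (@bigmin_le_cond _ nat _ n (cyclotomic_coset q x) _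
  (fun C : {set 'Z_n} => #|C|)).
rewrite imset_f //=.
apply/eqP => /setP /(_ x); rewrite !inE in_orbit => /esym/eqP x0.
by move: nm_gt0; rewrite -valx x0.
Qed.

(** * Conjugation as a ring involution *)

Section ConjugationMorphism.

Variables (F : finFieldType) (gT : finGroupType) (cG : abelian [set: gT]).

Definition cgconj (a : cgalg F cG) : cgalg F cG := gconj a.

Lemma cgconj_is_zmod_morphism : zmod_morphism cgconj.
Proof. by move=> a b; apply/ffunP => x; rewrite !ffunE /coef !ffunE. Qed.

Lemma cgconj_is_monoid_morphism : monoid_morphism cgconj.
Proof.
split; first by apply/ffunP => x; rewrite !ffunE /coef !ffunE invg_eq1.
move=> a b; apply/ffunP => z; rewrite !ffunE /coef !ffunE.
rewrite (reindex_inj invg_inj); apply: eq_bigr => x _.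
rewrite /coef !ffunE /coef; congr (_ * b _).
by rewrite -!invMg; congr (_^-1)%g; apply: (centsP cG); rewrite inE.
Qed.

HB.instance Definition _ := GRing.isZmodMorphism.Build _ _ cgconj
  cgconj_is_zmod_morphism.
HB.instance Definition _ := GRing.isMonoidMorphism.Build _ _ cgconj
  cgconj_is_monoid_morphism.

Lemma cgconjK : involutive cgconj.
Proof. by move=> a; apply/ffunP => x; rewrite !ffunE /coef !ffunE invgK. Qed.

End ConjugationMorphism.

(** * Information sets of linear codes *)

Section InformationSets.

Variables (F : finFieldType) (gT : finGroupType).
Notation FG := (galg F gT).

Definition subspace_set (I : {set FG}) :=
  [/\ 0 \in I, {in I &, forall a b, a + b \in I} &
      {in I, forall a k, k *: a \in I}].

(** [X] is a minimal set of coordinates on which restriction from [I] is injective; minimality makes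
    the restriction surjective as well. *)
Lemma information_set (I : {set FG}) : subspace_set I ->
  {X : {set gT} | #|I| = (#|F| ^ #|X|)%N &
    {in I, forall a, (forall x, x \in X -> coef a x = 0) -> a = 0}}.
Proof.
move=> [I0 ID IZ].
pose inf (X : {set gT}) :=
  [forall a in I, [forall x in X, coef a x == 0] ==> (a == 0)].
have infP (X : {set gT}) : reflect
    {in I, forall a, (forall x, x \in X -> coef a x = 0) -> a = 0} (inf X).
  apply: (iffP forall_inP) => [h a aI az|h a aI].
    by apply/eqP/(implyP (h a aI))/forall_inP => x xX; rewrite az.
  by apply/implyP => /forall_inP az; rewrite [a]h // => x /az /eqP.
have [|X /minsetP[/infP infX minX]] := @ex_minset _ inf.
  exists setT; apply/infP => a _ a0; apply: galg_ext => x.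
  by rewrite gcoef0 a0.
exists X => //; apply/eqP; rewrite eqn_leq; apply/andP; split.
  rewrite -(card_pffun_on 0 (mem X) predT) -[leqRHS]cardsE.
  pose f (a : FG) := [ffun x => if x \in X then coef a x else 0].
  rewrite -(@card_in_imset _ _ f I).
    apply/subset_leq_card/subsetP => _ /imsetP[a _ ->]; rewrite in_set.
    by apply/pffun_onP; split=> //; apply/supportP => x nX; rewrite ffunE (negbTE nX).
  move=> a b aI bI /ffunP ab; apply/eqP; rewrite -subr_eq0; apply/eqP.
  apply: infX; first by rewrite ID // -scaleN1r IZ.
  move=> x xX; have := ab x; rewrite !ffunE xX => abx.
  by rewrite gcoefD -scaleN1r gcoefZ abx mulN1r subrr.
(* Without [x] injectivity fails: some nonzero [a] vanishes on the rest of [X] but not at [x], and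
   is scaled to a dual vector. *)
have dual x : x \in X -> exists2 c, c \in I &
    forall y, y \in X -> coef c y = (y == x)%:R.
  move=> xX; have : ~~ inf (X :\ x).
    apply/negP => /minX /(_ (subsetDl _ _)) XE.
    by move: xX; rewrite -XE !inE eqxx.
  rewrite negb_forall_in => /exists_inP[a aI]; rewrite negb_imply.
  move=> /andP[/forall_inP az na].
  have nax : coef a x != 0.
    apply: contra na => /eqP ax; apply/eqP/infX => // y yX.
    by have [->//|nyx] := eqVneq y x; apply/eqP/az; rewrite !inE nyx.
  exists ((coef a x)^-1 *: a); first exact: IZ.
  move=> y yX; rewrite gcoefZ; have [->|nyx] := eqVneq y x; first by rewrite mulVf.
  by rewrite (eqP (az y _)) ?mulr0 // !inE nyx.
pose c x := odflt 0 [pick c in I | [forall y in X, coef c y == (y == x)%:R]].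
have cP x : x \in X -> c x \in I /\ forall y, y \in X -> coef (c x) y = (y == x)%:R.
  rewrite /c => /dual[a aI ha]; case: pickP => [b /andP[bI /forall_inP hb]|/(_ a)] /=.
    by split=> // y /hb /eqP.
  by rewrite aI /= => /forall_inP; case=> y /ha ->.
rewrite -(card_pffun_on 0 (mem X) predT) -[leqLHS]cardsE.
pose f (h : {ffun gT -> F}) : FG := \sum_(x in X) h x *: c x.
have fE h y : y \in X -> coef (f h) y = h y.
  move=> yX; rewrite gcoef_sum (bigD1 y) //= big1 ?addr0.
    by rewrite gcoefZ (cP y yX).2 // eqxx mulr1.
  by move=> x /andP[xX nx]; rewrite gcoefZ (cP x xX).2 // eq_sym (negbTE nx) mulr0.
rewrite -(@card_in_imset _ _ f).
  apply/subset_leq_card/subsetP => _ /imsetP[h _ ->].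
  apply: (big_ind (fun a => a \in I)) => // x xX.
  exact/IZ/(cP x xX).1.
move=> h k /[!in_set] /pffun_onP[/supportP h0 _] /pffun_onP[/supportP k0 _] fhk.
apply/ffunP => y; have [yX|nyX] := boolP (y \in X).
  by rewrite -(fE h) // fhk fE.
by rewrite h0 // k0.
Qed.

End InformationSets.

(** * Size of a component moved by the group *)

Section CornerDimension.

Variables (F : finFieldType) (gT : finGroupType) (cG : abelian [set: gT]).
Let A : finComNzRingType := cgalg F cG.
Let q := #|F|.
Let n := #|gT|.
Hypothesis cnq : coprime n q.

Let q_gt1 : (1 < q)%N. Proof. exact: finNzRing_gt1. Qed.
Let n_gt0 : (0 < n)%N. Proof. by apply/card_gt0P; exists 1%g. Qed.

Lemma cgalg_frobenius_exp : {Q | forall a : A, a ^+ Q.+2 = a}.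
Proof.
exists (q ^ totient n - 2)%N => a.
have : (1 < q ^ totient n)%N by rewrite -(exp1n (totient n)) ltn_exp2r ?totient_gt0.
case: (q ^ totient n)%N (cgalg_frobenius_id a cnq) => [|[|Q]] //= aQ _.
by rewrite subSS subn1.
Qed.

Lemma subspace_corner (e : A) : @subspace_set F gT (corner e).
Proof.
split; first exact: (@corner0 A e).
  by move=> a b; apply: (@cornerD A).
move=> a ae k; apply/(@cornerP A e).
change ((k *: (a : galg F gT)) * (e : galg F gT) = k *: (a : galg F gT)).
by rewrite -scalerAl; congr (_ *: _); apply/(@cornerP A e).
Qed.

(** With |Ae| = q^d, the order of g e in the field Ae divides both n and q^d - 1; as g e is not [e],
    their gcd exceeds 1 and [mu_le] applies to it. *)
Lemma card_corner_ge (e : A) (g : gT) : (1 < n)%N -> e \in prim_idem A ->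
  (delta F g : A) * e != e -> (q ^ mu q n <= #|corner e|)%N.
Proof.
move=> n_gt1 Pe nge; have [Q AQ] := cgalg_frobenius_exp.
have [X cX _] := information_set (subspace_corner e).
have {}cX : #|corner e| = (q ^ #|X|)%N := cX.
have d_gt0 : (0 < #|X|)%N.
  have := card_corner_gt1 Pe; rewrite cX.
  by case: #|X|.
pose th : A := delta F g; have thX k : th ^+ k = delta F (g ^+ k)%g.
  exact: deltaX.
have thn : th ^+ n = 1 by rewrite thX /n -cardsT expg_cardG ?inE.
have nth : th * e != 0.
  apply: contra (prim_idem_neq0 Pe) => /eqP the.
  by rewrite -[e]mul1r -thn -(prednK n_gt0) exprSr -mulrA the mulr0.
have thN : th ^+ (q ^ #|X| - 1) * e = e.
  have eX k : e ^+ k.+1 = e.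
    by elim: k => [|k IH]; rewrite ?expr1 // exprS IH prim_idem_idem.
  have := expr_card_corner AQ Pe (mem_corner th Pe) nth.
  by rewrite cX -subn1 exprMn -mulrA -exprSr eX.
rewrite cX leq_exp2l //.
have gcd_gt0 : (0 < gcdn (q ^ #|X| - 1) n)%N by rewrite gcdn_gt0 n_gt0 orbT.
apply: (mu_le n_gt1 d_gt0 (m := gcdn (q ^ #|X| - 1) n)).
- rewrite ltn_neqAle gcd_gt0 andbT eq_sym; apply: contra nge => /eqP g1.
  (* If the gcd were 1, Bezout would write 1 as [kn * n] minus a multiple of q^d - 1, giving g e =
     e. *)
  case: (egcdnP (q ^ #|X| - 1) n_gt0) => kn kX; rewrite gcdnC g1 => bez _.
  have thm k j : th ^+ j * e = e -> th ^+ (k * j) * e = e.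
    by move=> thj; elim: k => [|k IH]; rewrite ?mul1r // mulSn exprD -mulrA IH.
  have := thm kn n; rewrite bez thn mul1r => /(_ erefl).
  by rewrite addn1 exprS -mulrA thm // => /eqP.
- exact: dvdn_gcdr.
- exact: dvdn_gcdl.
exact: ltnW.
Qed.

End CornerDimension.

(** * Words of small weight in an ideal *)

Section LightWords.

Variables (R : realType) (F : finFieldType) (gT : finGroupType).
Notation FG := (galg F gT).
Let q := #|F|.
Let n := #|gT|.

Let n_gt0 : (0 < n)%N. Proof. by apply/card_gt0P; exists 1%g. Qed.
Let q_gt1 : (1 < q)%N. Proof. exact: finNzRing_gt1. Qed.

Definition weight_on (X : {set gT}) (a : FG) : nat :=
  #|[set x in X | coef a x != 0]|.

(** Restriction embeds [I] in the functions on [X], and over all of these the sum factors into one 1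
    + (q - 1) t per coordinate. *)
Lemma weight_enumerator_le (t : R) (I : {set FG}) (X : {set gT}) : 0 <= t ->
  subspace_set I ->
  {in I, forall a, (forall x, x \in X -> coef a x = 0) -> a = 0} ->
  \sum_(a in I) t ^+ weight_on X a <= (1 + (q%:R - 1) * t) ^+ #|X|.
Proof.
move=> t_ge0 [_ ID IZ] infX.
pose phi (c : F) : R := if c == 0 then 1 else t.
have sum_phi : \sum_c phi c = 1 + (q%:R - 1) * t.
  rewrite (bigD1 0) //= /phi eqxx; congr (_ + _).
  rewrite (eq_bigr (fun=> t)) => [|c /negbTE -> //].
  rewrite sumr_const -[LHS]mulr_natl; congr (_ * _).
  rewrite -(natrB _ (ltnW q_gt1)) subn1; congr (_%:R).
  by rewrite -(cardC1 (0 : F)); apply: eq_card => c.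
pose G (h : {ffun gT -> F}) := \prod_(x in X) phi (h x).
have -> : (1 + (q%:R - 1) * t) ^+ #|X| = \sum_(h in pffun_on 0 (mem X) predT) G h.
  by rewrite -sum_phi -prodr_const (big_distr_big 0).
pose f (a : FG) := [ffun x => if x \in X then coef a x else 0].
have injf : {in I &, injective f}.
  move=> a b aI bI /ffunP ab; apply/eqP; rewrite -subr_eq0; apply/eqP.
  apply: infX; first by rewrite ID // -scaleN1r IZ.
  move=> x xX; have := ab x; rewrite !ffunE xX => abx.
  by rewrite gcoefD -scaleN1r gcoefZ abx mulN1r subrr.
have -> : \sum_(a in I) t ^+ weight_on X a = \sum_(h in f @: I) G h.
  rewrite big_imset //; apply: eq_bigr => a _; rewrite /G /weight_on.
  rewrite -sum1_card -prodrXr big_mkcond [RHS]big_mkcond; apply: eq_bigr => x _.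
  by rewrite inE ffunE /phi; case: (x \in X) => //=; case: eqP.
rewrite [leRHS](bigID (mem (f @: I))) /= -[leLHS]addr0 lerD //.
  rewrite le_eqVlt; apply/orP; left; apply/eqP; apply: eq_bigl => h.
  apply/idP/andP => [hI|[]//]; split=> //; have /imsetP[a _ ->] := hI.
  by apply/pffun_onP; split=> //; apply/supportP => x nX; rewrite ffunE (negbTE nX).
apply: sumr_ge0 => h _; apply: prodr_ge0 => x _.
by rewrite /phi; case: ifP.
Qed.

(** Double counting: for fixed [x] in [X], the element g^-1 x runs through the group as g does. *)
Lemma sum_weight_on X (a : FG) :
  (\sum_g weight_on X (delta F g * a)%R = #|X| * weight_on setT a)%N.
Proof.
have wE (Y : {set gT}) (b : FG) : weight_on Y b = (\sum_(x in Y) (coef b x != 0%R))%N.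
  rewrite /weight_on -sum1_card [RHS]big_mkcond [LHS]big_mkcond.
  by apply: eq_bigr => x _; rewrite inE; case: (x \in Y) => //=; case: eqP.
under eq_bigr => g _ do rewrite wE.
rewrite exchange_big -sum_nat_const /=; apply: eq_bigr => x _; rewrite wE.
rewrite (reindex_inj (inj_comp (mulgI x) invg_inj)) /= big_mkcond /=.
rewrite [RHS]big_mkcond; apply: eq_bigr => g _; rewrite inE.
by rewrite coef_delta_mul invMg invgK mulgKV.
Qed.

Lemma hamming_weightE (c : FG * FG) :
  hamming_weight c = (weight_on setT c.1 + weight_on setT c.2)%N.
Proof.
by rewrite /hamming_weight /weight_on; congr (_ + _)%N; apply: eq_card => x; rewrite !inE.
Qed.

Definition translation_stable (I : {set FG}) :=
  forall g, {in I, forall a, delta F g * a \in I}.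

Definition light_words (delta : R) (I : {set FG}) : {set FG * FG} :=
  [set c in setX I I | (hamming_weight c)%:R <= delta * (2 * n)%N%:R].

(* AM-GM over the translates of an information set turns the weight of a word
   into an average of weights on information sets. *)
Lemma card_light_words_expo (t d : R) (I : {set FG}) (X : {set gT}) :
  0 < t -> t <= 1 -> subspace_set I -> translation_stable I ->
  {in I, forall a, (forall x, x \in X -> coef a x = 0) -> a = 0} ->
  #|light_words d I|%:R * t `^ (2 * #|X|%:R * d)
    <= (1 + (q%:R - 1) * t) ^+ (2 * #|X|).
Proof.
move=> t_gt0 t_le1 sI tI infX; set k := #|X|.
have t_ge0 := ltW t_gt0.
pose E (c : FG * FG) g : R :=
  t ^+ (weight_on X (galg_mul (delta F g) c.1) + weight_on X (galg_mul (delta F g) c.2)).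
have E_ge0 c g : 0 <= E c g by rewrite exprn_ge0.
have nR : n%:R != 0 :> R by rewrite pnatr_eq0 -lt0n.
pose avg c := (\sum_g E c g) / n%:R.
have avgP c : c \in light_words d I -> t `^ (2 * k%:R * d) <= avg c.
  rewrite inE => /andP[_ lc].
  have avg_ge0 : 0 <= avg c by rewrite divr_ge0 ?sumr_ge0.
  rewrite -(@ler_pXn2r _ n) ?nnegrE ?powR_ge0 //.
  have prodE : \prod_g E c g = t ^+ (k * hamming_weight c).
    by rewrite prodrXr big_split /= !sum_weight_on -mulnDr -hamming_weightE.
  (* The geometric mean of the [E c g] is t^(k wt(c) / n), which for light [c] is at least t^(2 k d)
     since t <= 1. *)
  have := leif_AGM (A := [pred g : gT | true]) (E := E c) (fun g _ => E_ge0 c g).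
  rewrite prodE; case=> agm _; apply: le_trans agm.
  rewrite -!powR_mulrn ?powR_ge0 // -powRrM ger_powR ?t_gt0 //.
  have -> : 2 * k%:R * d * n%:R = k%:R * (d * (2 * n)%N%:R) by rewrite natrM; ring.
  by rewrite natrM ler_wpM2l.
have transl g : \sum_(a in I) t ^+ weight_on X (delta F g * a)
    = \sum_(a in I) t ^+ weight_on X a.
  have inj : {in I &, injective (fun a : FG => delta F g * a)}.
    move=> a b _ _ ab; have := congr1 (fun c => delta F g^-1%g * c) ab.
    by rewrite !mulrA deltaM mulVg delta1 !mul1r.
  have im : [set delta F g * a | a in I] = I.
    apply/eqP; rewrite eqEcard (card_in_imset inj) leqnn andbT.
    by apply/subsetP => _ /imsetP[a aI ->]; apply: tI.
  by rewrite -[in RHS]im big_imset.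
have W_ge0 : 0 <= \sum_(a in I) t ^+ weight_on X a.
  by apply: sumr_ge0 => a _; rewrite exprn_ge0.
(* Translation by [g] permutes [I], so every [g] contributes the same square. *)
have sumavg : \sum_(c in setX I I) avg c = (\sum_(a in I) t ^+ weight_on X a) ^+ 2.
  rewrite -mulr_suml exchange_big /=.
  rewrite (eq_bigr (fun=> (\sum_(a in I) t ^+ weight_on X a) ^+ 2)); last first.
    move=> g _; rewrite expr2 -{1}(transl g) -(transl g) big_distrlr /=.
    rewrite pair_big_dep /=; apply: eq_big => [[a b]|[a b] _]; first by rewrite in_setX.
    by rewrite -exprD.
  rewrite sumr_const -[X in X / _]mulr_natr; apply: mulfK nR _.
rewrite mulnC exprM; apply: (@le_trans _ _ ((\sum_(a in I) t ^+ weight_on X a) ^+ 2)).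
  rewrite -sumavg mulr_natl -sumr_const.
  rewrite [leRHS](bigID (mem (light_words d I))) /= -[leLHS]addr0 lerD //.
    rewrite [leRHS](eq_bigl (mem (light_words d I))); first exact: ler_sum.
    by move=> c; rewrite !inE; case: (_ && (c.2 \in I)).
  by apply: sumr_ge0 => c _; rewrite divr_ge0 ?sumr_ge0.
rewrite lerXn2r ?nnegrE //; last exact: weight_enumerator_le.
by rewrite exprn_ge0 // addr_ge0 // mulr_ge0 // subr_ge0 ler1n ltnW.
Qed.

Lemma qentropy_ge0 (d : R) : 0 <= d -> d <= 1 - q%:R^-1 -> 0 <= qentropy q d.
Proof.
move=> d_ge0 d_le; rewrite /qentropy; case: eqP => // /eqP nd.
have d_gt0 : 0 < d by rewrite lt_def nd.
have q1 : 1 < q%:R :> R by rewrite ltr1n.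
have q0 : 0 < q%:R :> R by lra.
have d_lt1 : d < 1 by apply: le_lt_trans d_le _; rewrite ltrBlDr ltrDl invr_gt0.
have q2 : 2 <= q%:R :> R by rewrite ler_nat.
have lq : 0 < ln q%:R :> R by rewrite ln_gt0.
have h1 : 0 <= ln (q%:R - 1) :> R by rewrite ln_ge0 //; lra.
have h2 : ln d <= 0 by rewrite ln_le0 // ltW.
have h3 : ln (1 - d) <= 0 by rewrite ln_le0 //; lra.
rewrite /logb !mulrA -!mulrBl; apply: divr_ge0; last exact: ltW.
have d1 : 0 <= 1 - d by rewrite subr_ge0 ltW.
have := mulr_ge0 d_ge0 h1; have := mulr_ge0_le0 d_ge0 h2.
have := mulr_ge0_le0 d1 h3; lra.
Qed.

Lemma card_light_words (d : R) (I : {set FG}) : 0 <= d -> d <= 1 - q%:R^-1 ->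
  subspace_set I -> translation_stable I ->
  #|light_words d I|%:R <= #|I|%:R `^ (2 * qentropy q d) :> R.
Proof.
(* For d = 0 only the zero word is light. *)
move=> d_ge0 d_le sI tI; rewrite /qentropy; case: eqP => [->|/eqP nd].
  rewrite mulr0 powRr0 (ler_nat _ _ 1).
  rewrite -(cards1 (0 : FG * FG)); apply/subset_leq_card/subsetP => -[a b].
  rewrite !inE mul0r (ler_nat _ _ 0) /=.
  move=> /andP[_]; rewrite leqn0 addn_eq0 !cards_eq0 => /andP[/eqP/setP za /eqP/setP zb].
  apply/eqP; congr pair; apply: galg_ext => x; rewrite gcoef0.
    by have := za x; rewrite !inE => /negbFE/eqP.
  by have := zb x; rewrite !inE => /negbFE/eqP.
have d_gt0 : 0 < d by rewrite lt_def nd.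
have q1 : 1 < q%:R :> R by rewrite ltr1n.
have q0 : 0 < q%:R :> R by lra.
have d_lt1 : d < 1 by apply: le_lt_trans d_le _; rewrite ltrBlDr ltrDl invr_gt0.
have [X cI infX] := information_set sI.
(* This [t] minimises the bound given by [card_light_words_expo]; t <= 1 amounts to d <= 1 - 1/q. *)
pose t : R := d / ((q%:R - 1) * (1 - d)).
have den_gt0 : 0 < (q%:R - 1) * (1 - d) by rewrite mulr_gt0 // subr_gt0.
have t_gt0 : 0 < t by rewrite divr_gt0.
have t_le1 : t <= 1.
  rewrite ler_pdivrMr // mul1r.
  have : d * q%:R <= (1 - q%:R^-1) * q%:R by rewrite ler_pM2r.
  by rewrite mulrBl mulVf ?mul1r; [lra|rewrite gt_eqF].
have := card_light_words_expo d t_gt0 t_le1 sI tI infX.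
have -> : 1 + (q%:R - 1) * t = (1 - d)^-1.
  rewrite /t; field; apply/andP; split; rewrite gt_eqF //; lra.
rewrite -ler_pdivlMr ?powR_gt0 // => /le_trans; apply.
rewrite cI /powR !gt_eqF ?ltr0n ?expn_gt0 ?(ltnW q_gt1) //.
have lnK1 : expR (ln (1 - d)) = 1 - d by rewrite lnK ?posrE ?subr_gt0.
rewrite -lnK1 -expRN -expRM_natl -expRN -expRD ler_expR.
rewrite /t ln_div ?posrE // lnM ?posrE ?subr_gt0 // natrX lnXn ?ltr0n ?(ltnW q_gt1) //.
rewrite natrM /logb -[ln q%:R *+ _]mulr_natl.
have lq : ln q%:R != 0 :> R by rewrite gt_eqF // ln_gt0.
(* With this [t] the bound is exactly |I|^(2h). *)
rewrite le_eqVlt; apply/orP; left; apply/eqP.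
by rewrite lnK1; field.
Qed.

End LightWords.

(** * Sums over sets of components *)

Lemma card_bigcup_le (I T : finType) (P : {set I}) (G : I -> {set T}) :
  (#|\bigcup_(i in P) G i| <= \sum_(i in P) #|G i|)%N.
Proof.
elim/big_rec2: _ => [|i m U _ IH]; first by rewrite cards0.
by apply: leq_trans (leq_add (leqnn _) IH); rewrite cardsU leq_subr.
Qed.

Section SubsetSums.

Variables (R : realFieldType) (I : finType) (D : pred I) (a y : I -> R) (x : R).

(** Dropping [a e] changes a factor by at most [x], at no more than [size s] places; the other
    factors are at most 1 + 2x where [D] holds and 3 elsewhere. *)
Lemma prod_sub_prod_le (s : seq I) : 0 <= x ->
  {in s, forall e, 0 <= a e <= 1} -> {in s, forall e, 0 <= y e <= a e} ->
  {in s, forall e, D e -> a e <= x} ->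
  \prod_(e <- s) (a e + (1 + y e))
    - \prod_(e <- s) ((if D e then 0 else a e) + (1 + y e))
  <= 3 ^+ count (predC D) s * ((size s)%:R * x * (1 + 2 * x) ^+ size s).
Proof.
move=> x_ge0 a1 ya ax.
suff [] : 0 <= \prod_(e <- s) (a e + (1 + y e))
      <= 3 ^+ count (predC D) s * (1 + 2 * x) ^+ size s /\
    \prod_(e <- s) (a e + (1 + y e))
      - \prod_(e <- s) ((if D e then 0 else a e) + (1 + y e))
      <= 3 ^+ count (predC D) s * ((size s)%:R * x * (1 + 2 * x) ^+ size s).
  by [].
elim: s a1 ya ax => [|e s IH] a1 ya ax.
  by rewrite !big_nil /= !expr0 !mul1r !mul0r subrr lexx ler01.
have /andP[a_ge0 a_le1] := a1 e (mem_head _ _).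
have /andP[y_ge0 y_le] := ya e (mem_head _ _).
have [|||/andP[F_ge0 F_le] IHd] := IH.
- by move=> i si; apply: a1; rewrite inE si orbT.
- by move=> i si; apply: ya; rewrite inE si orbT.
- by move=> i si; apply: ax; rewrite inE si orbT.
have {}ax := ax e (mem_head _ _).
rewrite !big_cons /=.
move: F_ge0 F_le IHd; set F := \prod_(j <- s) (a j + _); set G := \prod_(j <- s) _.
set c := 3 ^+ _; set w := (1 + 2 * x) ^+ size s; set m := size s => F_ge0 F_le IHd.
have c_ge0 : 0 <= c by rewrite exprn_ge0.
have w_ge0 : 0 <= w by rewrite exprn_ge0 //; lra.
have m_ge0 : 0 <= m%:R :> R by [].
have cw_ge0 : 0 <= c * w by rewrite mulr_ge0.
have cmxw : 0 <= c * (m%:R * x * w) by rewrite !mulr_ge0.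
rewrite [(1 + 2 * x) ^+ _]exprS -/w; case: (D e) ax => /= ax.
  have {}ax := ax isT; rewrite add0n -/c; split.
    rewrite mulr_ge0 ?addr_ge0 //=.
    apply: le_trans (_ : (1 + 2 * x) * (c * w) <= _); last by rewrite mulrCA.
    by apply: ler_pM => //; rewrite ?addr_ge0 //; lra.
  rewrite (_ : _ - _ = (1 + y e) * (F - G) + a e * F); last by ring.
  rewrite -natr1 (_ : c * _ = 
    (1 + 2 * x) * (c * (m%:R * x * w)) + x * (c * w)
    + 2 * (x * (x * (c * w)))); last by ring.
  rewrite -[leLHS]addr0; apply: lerD; last by rewrite !mulr_ge0.
  apply: lerD; last exact: ler_pM.
  apply: (@le_trans _ _ ((1 + y e) * (c * (m%:R * x * w)))).
    by rewrite ler_wpM2l // addr_ge0.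
  by rewrite ler_wpM2r //; lra.
rewrite add1n exprS -/c; split.
  rewrite mulr_ge0 ?addr_ge0 //=.
  apply: (@le_trans _ _ (3 * (c * w))).
    by apply: ler_pM => //; rewrite ?addr_ge0 //; lra.
  rewrite (_ : _ * _ * (_ * w) = 3 * (c * w) + 6 * (x * (c * w))); last by ring.
  by rewrite lerDl !mulr_ge0.
rewrite -mulrBr; apply: (@le_trans _ _ ((a e + (1 + y e)) * (c * (m%:R * x * w)))).
  by rewrite ler_wpM2l // !addr_ge0.
apply: (@le_trans _ _ (3 * (c * (m%:R * x * w)))).
  by rewrite ler_wpM2r //; lra.
rewrite -[leRHS]mulrA ler_wpM2l // ler_wpM2l //.
rewrite -natr1 (_ : _ * _ * (_ * w) = m%:R * x * w + x * w
  + 2 * (x * (m%:R * x * w)) + 2 * (x * (x * w))); last by ring.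
by rewrite -!addrA lerDl !addr_ge0 // !mulr_ge0.
Qed.

(** Both products expand over the subsets of [P]; in the second only those avoiding [D] survive,
    with unchanged terms, so the difference keeps those meeting [D]. *)
Lemma sum_subsets_prod (P : {set I}) :
  \sum_(S : {set I} | (S \subset P) && [exists e in S, D e])
    (\prod_(e in S) a e * \prod_(e in P :\: S) (1 + y e))
  = \prod_(e in P) (a e + (1 + y e))
    - \prod_(e in P) ((if D e then 0 else a e) + (1 + y e)).
Proof.
have expand (b : I -> R) : \prod_(e in P) (b e + (1 + y e)) =
  \sum_(S : {set I} | S \subset P)
    (\prod_(e in S) b e * \prod_(e in P :\: S) (1 + y e)).
  rewrite big_mkcond /=.
  rewrite (eq_bigr (fun e => (if e \in P then b e else 0)
     + (if e \in P then 1 + y e else 1))); last first.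
    by move=> e _; case: ifP => //; rewrite add0r.
  rewrite bigA_distr /= [RHS]big_mkcond /=; apply: eq_bigr => S _.
  case: ifPn => [sS|/subsetPn[e eS nP]]; last first.
    by rewrite (bigD1 e) //= eS (negbTE nP) mul0r.
  rewrite [X in _ = X * _]big_mkcond [X in _ = _ * X]big_mkcond -big_split /=.
  apply: eq_bigr => e _; rewrite inE; case: (boolP (e \in S)) => eS /=.
    by rewrite (subsetP sS e eS) mulr1.
  by rewrite mul1r.
rewrite !expand [X in _ = X - _](bigID (fun S : {set I} => [exists e in S, D e])) /=.
rewrite [X in _ = _ - X](bigID (fun S : {set I} => [exists e in S, D e])) /=.
rewrite [X in _ = _ - (X + _)]big1 ?add0r; last first.
  move=> S /andP[_ /exists_inP[e eS De]].
  by rewrite (bigD1 e) //= De !mul0r.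
rewrite [X in _ = _ - X](eq_bigr (fun S : {set I} =>
  \prod_(e in S) a e * \prod_(e in P :\: S) (1 + y e))) ?addrK //.
move=> S /andP[_ /exists_inPn nD]; congr (_ * _); apply: eq_bigr => e eS.
by rewrite (negbTE (nD e eS)).
Qed.

End SubsetSums.

Lemma expr_1D2x_le9 (R : realType) (x : R) n r : 0 <= x -> n%:R * x <= 1 -> (r <= n)%N ->
  (1 + 2 * x) ^+ r <= 9.
Proof.
move=> x_ge0 nx rn; apply: (@le_trans _ _ (expR (2 * (n%:R * x)))).
  rewrite mulrCA expRM_natl; apply: (@le_trans _ _ (expR (2 * x) ^+ r)).
    by rewrite lerXn2r ?nnegrE ?expR_ge0 ?expR_ge1Dx //; lra.
  by rewrite ler_weXn2l // -[leLHS]expR0 ler_expR; lra.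
apply: (@le_trans _ _ (expR 2)); first by rewrite ler_expR; lra.
(* This follows from e^(-1/6) >= 5/6, and yields e^2 <= (6/5)^12 < 9. *)
have e6 : expR (6^-1 : R) <= 6 / 5.
  have := expR_ge1Dx (- 6^-1 : R); rewrite expRN => h.
  have e_gt0 := expR_gt0 (6^-1 : R).
  have : (1 - 6^-1) * expR 6^-1 <= 1 :> R.
    by rewrite -ler_pdivlMr // mul1r.
  by lra.
rewrite (_ : (2 : R) = 12%:R * 6^-1); last by field.
rewrite expRM_natl; apply: (@le_trans _ _ ((6 / 5) ^+ 12)).
  by rewrite lerXn2r ?nnegrE ?expR_ge0 //; lra.
by rewrite !exprS expr0; lra.
Qed.

(** * Counting light codes *)

Section Assembly.

Variables (R : realType) (F : finFieldType) (gT : finGroupType).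
Variable cG : abelian [set: gT].
Notation FG := (galg F gT).
Let A : finComNzRingType := cgalg F cG.
Let q := #|F|.
Let n := #|gT|.
Let P : {set A} := prim_idem A.
Hypothesis n_gt1 : (1 < n)%N.
Hypothesis cnq : coprime n q.

Let q_gt1 : (1 < q)%N. Proof. exact: finNzRing_gt1. Qed.

Let conj : {rmorphism A -> A} := @cgconj F gT cG.
Let conjK : involutive conj. Proof. exact: cgconjK. Qed.

Definition moved (e : A) : bool := [exists g, (delta F g : A) * e != e].

Lemma unmovedP (u : A) : reflect (forall g, (delta F g : A) * u = u) (~~ moved u).
Proof.
rewrite negb_exists; apply: (iffP forallP) => h g; last by rewrite h eqxx.
by have := h g; rewrite negbK => /eqP.
Qed.

Lemma unmoved_coef (u : A) x : ~~ moved u -> coef (u : FG) x = coef (u : FG) 1%g.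
Proof.
move/unmovedP => h; have := coef_delta_mul x^-1%g (u : FG) 1%g.
by rewrite invgK mulg1 => <-; congr coef; apply: h.
Qed.

Lemma unmoved_weight (u : FG) : u != 0 -> ~~ moved u -> weight_on setT u = n.
Proof.
move=> nu fu; rewrite /weight_on -[RHS]cardsT; apply: eq_card => x.
rewrite !inE (unmoved_coef x fu); apply: contra nu => /eqP u0.
by apply/eqP; apply: galg_ext => y; rewrite (unmoved_coef y fu) u0 gcoef0.
Qed.

Lemma natr_order_neq0 : n%:R != 0 :> F.
Proof.
have [p p_pr pF] := finPcharP F.
rewrite -(dvdn_pcharf pF); apply/negP => pn.
have pq : (p %| q)%N.
  have pg : p.-nat q.
    rewrite /q -cardsT; exact: abelem_pgroup (fin_ring_pchar_abelem pF).
  have := pnatPpi pg (_ : pdiv q \in \pi(q)); rewrite pi_pdiv => /(_ q_gt1).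
  by rewrite inE => /eqP <-; apply: pdiv_dvd.
have : (p %| gcdn n q)%N by rewrite dvdn_gcd pn.
by rewrite (eqP cnq) dvdn1 => /eqP p1; rewrite p1 in p_pr.
Qed.

(** Unmoved idempotents are constant on the group; a product of two has coefficient n times the
    product of the constants, which is nonzero in [F], whereas distinct ones are orthogonal. *)
Lemma card_unmoved_le1 : (#|[set e in P | ~~ moved e]| <= 1)%N.
Proof.
apply/card_le1_eqP => e f; rewrite inE => /andP[Pe fe]; rewrite inE => /andP[Pf ff].
apply/eqP/negPn/negP; rewrite eq_sym => nef.
have ef : (e : FG) * (f : FG) = 0 := prim_idem_orth Pe Pf nef.
have := gcoef0 F (1%g : gT); rewrite -ef /coef ffunE.
rewrite (eq_bigr (fun=> coef (e : FG) 1%g * coef (f : FG) 1%g)); last first.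
  by move=> x _; rewrite (unmoved_coef x fe) (unmoved_coef _ ff).
rewrite sumr_const -mulr_natl => /eqP; rewrite !mulf_eq0 (negbTE natr_order_neq0) /=.
have nz (u : A) : u \in P -> ~~ moved u -> coef (u : FG) 1%g != 0.
  move=> Pu fu; apply: contra (prim_idem_neq0 Pu) => /eqP u0.
  by apply/eqP; apply: galg_ext => x; rewrite (unmoved_coef x fu) u0 gcoef0.
by rewrite (negbTE (nz _ Pe fe)) (negbTE (nz _ Pf ff)).
Qed.

Let N (e : A) : R := #|corner e|%:R.

Lemma card_corner_ge_q e : e \in P -> (q <= #|corner e|)%N.
Proof.
move=> Pe; have [X cX _] := information_set (@subspace_corner F gT cG e).
have {}cX : #|corner e| = (q ^ #|X|)%N := cX.
have := card_corner_gt1 Pe; rewrite cX; case: #|X| => [|k] // _.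
by rewrite expnS leq_pmulr // expn_gt0 ltnW.
Qed.

Lemma card_galg : #|A| = (q ^ n)%N.
Proof. exact: card_ffun. Qed.

Lemma card_prim_idem_le : (#|P| <= n)%N.
Proof.
rewrite -(leq_exp2l _ _ q_gt1) -card_galg.
apply: leq_trans (prod_card_corner A); rewrite -prod_nat_const.
exact: leq_prod card_corner_ge_q.
Qed.

Definition supp (u : A) : {set A} := [set e in P | u * e != 0].

Lemma subspace_vanish (S : {set A}) : @subspace_set F gT (vanish S).
Proof.
split; first by rewrite inE; apply/forall_inP => e _; rewrite mul0r.
  move=> a b; rewrite !inE => /forall_inP za /forall_inP zb.
  apply/forall_inP => e eS.
  have -> : (a + b : A) * e = a * e + b * e by rewrite mulrDl.
  by rewrite (eqP (za e eS)) (eqP (zb e eS)) addr0.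
move=> a; rewrite inE => /forall_inP za k; rewrite inE; apply/forall_inP => e eS.
have -> : ((k *: (a : FG) : A) * e) = k *: ((a : FG) * (e : FG)) :> FG.
  by rewrite scalerAl.
by have /eqP -> : (a : FG) * (e : FG) == 0 := za e eS; rewrite scaler0.
Qed.

Lemma translation_vanish (S : {set A}) : @translation_stable F gT (vanish S).
Proof.
move=> g a; rewrite !inE => /forall_inP za; apply/forall_inP => e eS.
have -> : ((delta F g * a : FG) : A) * e = (delta F g : A) * ((a : A) * e).
  by rewrite mulrA.
by rewrite (eqP (za e eS)) mulr0.
Qed.

Variable d : R.
Hypotheses (d_ge0 : 0 <= d) (d_le : d <= 1 - q%:R^-1).

Let d_lt1 : d < 1.
Proof.
apply: le_lt_trans d_le _.
by rewrite ltrBlDr ltrDl invr_gt0 ltr0n ltnW.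
Qed.

Let h := qentropy q d.
Let h_ge0 : 0 <= h. Proof. exact: qentropy_ge0. Qed.

Definition light_multipliers : {set A} := [set b : A | (b * conj b == -1) &&
  [exists u : A, (u != 0) &&
    ((hamming_weight ((u, u * b) : FG * FG))%:R <= d * (2 * n)%N%:R)]].

Lemma codesD_le_light : (#|codesD_le F gT d| <= #|light_multipliers|)%N.
Proof.
apply: leq_trans (leq_imset_card (fun b : A => code1 (b : FG)) light_multipliers).
apply/subset_leq_card/subsetP => C; rewrite inE => /andP[/imsetP[b]].
rewrite inE => bb -> low; apply/imsetP; exists b => //; rewrite inE; apply/andP; split=> //.
have n2_gt0 : 0 < (2 * n)%N%:R :> R by rewrite ltr0n muln_gt0 (ltnW n_gt1).
apply: contraTT low => /existsPn heavy; rewrite -ltNge ltr_pdivlMr //.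
(* The default 2n of the minimum also exceeds the threshold, because d < 1. *)
apply: (big_ind (fun m : nat => d * (2 * n)%N%:R < m%:R)).
- by rewrite -[ltRHS]mul1r ltr_pM2r.
- by move=> x y hx hy; rewrite /Order.min; case: ifP.
move=> _ /andP[/imsetP[u _ ->] nz].
have := heavy u; rewrite negb_and negbK -ltNge => /orP[/eqP u0|//].
by case/eqP: nz; rewrite u0 mul0r.
Qed.

Lemma supp_moved (b u : A) : b * conj b = -1 -> u != 0 ->
  (hamming_weight ((u, u * b) : FG * FG))%:R <= d * (2 * n)%N%:R ->
  [exists e in supp u, moved e].
Proof.
move=> bb nu light; apply: contraT => /exists_inPn unm.
have fu : ~~ moved u.
  apply/unmovedP => g; apply: eq_prim_idem => e Pe.
  have [ue0|nue] := eqVneq (u * e) 0; first by rewrite -mulrA ue0 mulr0.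
  have eS : e \in supp u by rewrite inE Pe.
  have /unmovedP ge := unm e eS.
  by rewrite mulrAC ge mulrC.
have fub : ~~ moved (u * b) by apply/unmovedP => g; rewrite mulrA (unmovedP _ fu).
have nub : u * b != 0.
  apply: contra nu => /eqP ub0; rewrite -oppr_eq0 -mulrN1 -bb mulrA ub0 mul0r //.
have n2_gt0 : 0 < (2 * n)%N%:R :> R by rewrite ltr0n muln_gt0 (ltnW n_gt1).
move: light; rewrite hamming_weightE /= !unmoved_weight // addnn -mul2n.
by rewrite leNgt -[ltRHS]mul1r ltr_pM2r // d_lt1.
Qed.

(** For [e] in [S], [u * e] is invertible in its component, so [u * b = c] prescribes [b * e];
    [card_norm_solutions] treats the rest. *)
Lemma card_solutions_le (S : {set A}) (u c : A) : supp u = S ->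
  #|[set b : A | (b * conj b == -1) && (u * b == c)]|%:R
    <= \prod_(e in P :\: S) (Num.sqrt (N e) + 1).
Proof.
move=> uS; have [Q AQ] := cgalg_frobenius_exp cG cnq.
apply: (card_norm_solutions AQ conjK R (subsetDl P S)).
  by move=> b; rewrite inE => /andP[/eqP].
move=> b b' e; rewrite inE => /andP[_ /eqP ub]; rewrite inE => /andP[_ /eqP ub'].
rewrite in_setD => /andP[nPS Pe].
have : e \in S by move: nPS; rewrite in_setD Pe andbT negbK.
rewrite -uS inE => /andP[_ nue].
apply: (prim_idem_cancel AQ Pe (w := u * e)) => //; try exact: mem_corner.
by rewrite mulrACA (mulrC b) ub mulrACA (mulrC b') ub'.
Qed.

(** A union bound over the support [S], the light words with that support, and the multipliers [b]
    compatible with a word. *)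
Lemma card_light_multipliers_le : #|light_multipliers|%:R <=
  \sum_(S : {set A} | (S \subset P) && [exists e in S, moved e])
    (\prod_(e in S) N e) `^ (2 * h) * \prod_(e in P :\: S) (Num.sqrt (N e) + 1).
Proof.
pose T : {set {set A}} := [set S : {set A} | (S \subset P) && [exists e in S, moved e]].
pose L (S : {set A}) : {set FG * FG} :=
  [set w in light_words d (vanish (P :\: S)) | supp w.1 == S].
pose Sol (w : FG * FG) : {set A} :=
  [set b : A | (b * conj b == -1) && ((w.1 : A) * b == w.2)].
have cover : light_multipliers \subset \bigcup_(S in T) \bigcup_(w in L S) Sol w.
  apply/subsetP => b; rewrite inE => /andP[/eqP bb /existsP[u /andP[nu light]]].
  apply/bigcupP; exists (supp u).
    rewrite inE (supp_moved bb nu light) andbT; apply/subsetP => e.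
    by rewrite inE => /andP[].
  apply/bigcupP; exists ((u, u * b) : FG * FG); last by rewrite inE bb !eqxx.
  rewrite inE eqxx andbT inE light andbT in_setX /=.
  have van e : e \in P :\: supp u -> u * e = 0.
    by rewrite in_setD => /andP[+ Pe]; rewrite inE Pe negbK => /eqP.
  by apply/andP; split; rewrite inE; apply/forall_inP => e /van ue; 
     [rewrite ue | rewrite mulrAC ue mul0r].
apply: (@le_trans _ _ (\sum_(S in T) \sum_(w in L S) #|Sol w|%:R)).
  under eq_bigr => S _ do rewrite -natr_sum.
  rewrite -natr_sum ler_nat; apply: leq_trans (subset_leq_card cover) _.
  apply: leq_trans (card_bigcup_le _ _) _; apply: leq_sum => S _.
  exact: card_bigcup_le.
have memT S : (S \in T) = (S \subset P) && [exists e in S, moved e] by rewrite inE.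
rewrite -[leRHS](eq_bigl _ _ memT).
apply: ler_sum => S _.
have prod_ge0 : 0 <= \prod_(e in P :\: S) (Num.sqrt (N e) + 1).
  by apply: prodr_ge0 => e _; rewrite addr_ge0 ?sqrtr_ge0.
apply: (@le_trans _ _ (#|L S|%:R * \prod_(e in P :\: S) (Num.sqrt (N e) + 1))).
  rewrite mulr_natl -sumr_const; apply: ler_sum => w.
  by rewrite inE => /andP[_ /eqP wS]; apply: card_solutions_le wS.
rewrite ler_wpM2r //.
apply: (@le_trans _ _ (#|light_words d (vanish (P :\: S))|%:R)).
  by rewrite ler_nat subset_leq_card //; apply/subsetP => w; rewrite inE => /andP[].
have lw := card_light_words d_ge0 d_le (subspace_vanish (P :\: S))
  (@translation_vanish (P :\: S)).
apply: (le_trans lw).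
apply: ge0_ler_powR; rewrite ?nnegrE //.
- by rewrite mulr_ge0.
- by apply: prodr_ge0 => e _; rewrite ler0n.
by rewrite -natr_prod ler_nat; apply: card_vanish.
Qed.

Let eps : R := 1 / 4 - h.
Let x : R := q%:R `^ (- (2 * (mu q n)%:R * eps)).

Lemma card_light_multipliers_bound : 0 < eps -> n%:R * x <= 1 ->
  #|light_multipliers|%:R <= (q ^ n)%:R `^ (2^-1) * (3 * (n%:R * x * 9)).
Proof.
move=> eps_gt0 nx_le1.
have x_ge0 : 0 <= x by rewrite powR_ge0.
have N_ge1 e : 1 <= N e by rewrite ler1n card_corner_gt0.
have N_ge0 e : 0 <= N e by rewrite ler0n.
have N_neq0 e : N e != 0 by rewrite gt_eqF // (lt_le_trans ltr01).
pose a e := N e `^ (- (2 * eps)); pose y e := (Num.sqrt (N e))^-1.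
have y_pow e : y e = N e `^ (- 2^-1) by rewrite powRN powR12_sqrt.
have a_le1 e : 0 <= a e <= 1.
  by rewrite powR_ge0 -[leRHS](powRr0 (N e)) ler_powR // oppr_le0; lra.
(* The exponents satisfy -1/2 <= -2 eps since h >= 0. *)
have y_le e : 0 <= y e <= a e.
  by rewrite y_pow powR_ge0 ler_powR // lerN2 /eps; have := h_ge0; lra.
have a_moved e : e \in P -> moved e -> a e <= x.
  move=> Pe /existsP[g nge].
  have q_gt0 : 0 < q%:R :> R by rewrite ltr0n ltnW.
  have Nq : q%:R ^+ mu q n <= N e.
    by rewrite -natrX ler_nat (card_corner_ge cnq n_gt1 Pe nge).
  rewrite /x /a !powRN lef_pV2 ?posrE ?powR_gt0 //; last first.
    by rewrite (lt_le_trans ltr01).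
  rewrite -mulrA mulrCA [leLHS]powRrM powR_mulrn ?(ltW q_gt0) //.
  apply: ge0_ler_powR; rewrite ?nnegrE ?exprn_ge0 ?mulr_ge0 ?(ltW q_gt0) //.
  exact: ltW.
have prod_powR (S : {set A}) r : (\prod_(e in S) N e) `^ r = \prod_(e in S) N e `^ r.
  suff [] : 0 <= \prod_(e in S) N e /\ 
    (\prod_(e in S) N e) `^ r = \prod_(e in S) N e `^ r by [].
  elim/big_rec2: _ => [|e u v _ [u_ge0 <-]]; first by rewrite powR1.
  by rewrite mulr_ge0 // powRM.
(* Factoring out sqrt N_e everywhere turns N_e^(2h) into N_e^(2h - 1/2) = a_e and sqrt N_e + 1 into
   1 + y_e. *)
have termE (S : {set A}) : S \subset P ->
  (\prod_(e in S) N e) `^ (2 * h) * \prod_(e in P :\: S) (Num.sqrt (N e) + 1)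
  = \prod_(e in P) Num.sqrt (N e) *
    (\prod_(e in S) a e * \prod_(e in P :\: S) (1 + y e)).
  move=> sS; rewrite [X in _ = X * _](big_setID S) /= (setIidPr sS) mulrACA.
  rewrite -!big_split /= prod_powR.
  congr (_ * _); apply: eq_bigr => e _.
    rewrite -powR12_sqrt // -powRD ?N_neq0 ?implybT //; congr (_ `^ _).
    by rewrite /eps; field.
  by rewrite mulrDr mulr1 mulfV ?sqrtr_eq0 -?ltNge ?(lt_le_trans ltr01) // addrC.
apply: le_trans card_light_multipliers_le _.
rewrite (eq_bigr _ (fun S (sS : _ && _) => termE S (andP sS).1)) -mulr_sumr.
rewrite sum_subsets_prod -![\prod_(e in P) (_ + _)]big_enum.
have sum_ge0 : 0 <= 3 * (n%:R * x * 9) by rewrite !mulr_ge0.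
apply: (@le_trans _ _ (\prod_(e in P) Num.sqrt (N e) * (3 * (n%:R * x * 9)))).
  apply: ler_wpM2l; first by apply: prodr_ge0 => e _; exact: sqrtr_ge0.
  have ax : {in enum P, forall e, moved e -> a e <= x}.
    by move=> e; rewrite mem_enum; apply: a_moved.
  apply: le_trans (prod_sub_prod_le x_ge0 (fun e _ => a_le1 e) (fun e _ => y_le e) ax) _.
  have cP : (size (enum P) <= n)%N by rewrite -cardE card_prim_idem_le.
  apply: ler_pM; rewrite ?mulr_ge0 ?exprn_ge0 ?addr_ge0 ?mulr_ge0 //.
    (* At most one idempotent is unmoved, so the power of 3 is at most 3. *)
    rewrite -[leRHS]expr1 ler_weXn2l ?ler1n //.
    rewrite -sum1_count big_enum_cond.
    apply: leq_trans card_unmoved_le1; rewrite -sum1_card leq_eqVlt.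
    by apply/orP; left; apply/eqP; apply: eq_bigl => e; rewrite inE.
  apply: ler_pM; rewrite ?mulr_ge0 ?exprn_ge0 ?addr_ge0 ?mulr_ge0 //.
    by rewrite ler_wpM2r // ler_nat.
  exact: expr_1D2x_le9 nx_le1 cP.
rewrite ler_wpM2r // (eq_bigr (fun e => N e `^ 2^-1)) => [|e _]; last first.
  by rewrite powR12_sqrt.
rewrite -prod_powR; apply: ge0_ler_powR; rewrite ?nnegrE ?invr_ge0 //.
  by apply: prodr_ge0.
by rewrite -natr_prod ler_nat -card_galg prod_card_corner.
Qed.

End Assembly.

(** * Absorbing the constants into the exponent *)

Theorem theorem4p13 (R : realType) (F : finFieldType) (gT : finGroupType)
  (q n : nat) (delta : R) :
  #|F| = q ->
  (1 < n)%N -> odd n -> coprime n q ->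
  #|gT| = n -> abelian [set: gT] ->
  0 <= delta -> delta <= 1 - q%:R^-1 ->
  0 < 1 / 4 - qentropy q delta - logb q%:R n%:R / (2 * (mu q n)%:R) ->
  #|codesD_le F gT delta|%:R
    <= q%:R `^ ((n%:R - 1) / 2
                - 2 * (mu q n)%:R
                  * (1 / 4 - qentropy q delta - logb q%:R n%:R / (mu q n)%:R)
                + 4).
Proof.
move=> Fq n_gt1 n_odd cnq Gn cG d_ge0 d_le; move: n_gt1 n_odd cnq d_le.
rewrite -Fq -Gn {q Fq n Gn}; set q := #|F|; set n := #|gT| => n_gt1 n_odd cnq d_le hyp.
(* Oddness gives n >= 3, so that a spare factor n absorbs a factor 3 at the end. *)
have n_ge3 : (3 <= n)%N by case: (n) n_gt1 n_odd => [|[|[|k]]].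
have q_gt1 : (1 < q)%N := finNzRing_gt1 F.
have q_gt0 : 0 < q%:R :> R by rewrite ltr0n ltnW.
have n_gt0 : 0 < n%:R :> R by rewrite ltr0n ltnW.
have lnq : 0 < ln q%:R :> R by rewrite ln_gt0 // ltr1n.
have M_gt0 : 0 < (mu q n)%:R :> R by rewrite ltr0n mu_gt0 // ltnW.
move: hyp; set h := qentropy q delta; set L := logb _ _; set M := (mu q n)%:R => hyp.
have qL : q%:R `^ L = n%:R.
  by rewrite /powR gt_eqF // /L /logb divfK ?gt_eqF // lnK ?posrE.
pose eps : R := 1 / 4 - h; pose x : R := q%:R `^ (- (2 * M * eps)).
have L_ge0 : 0 <= L by rewrite divr_ge0 ?ln_ge0 ?ler1n ?(ltW lnq) // ltnW.
(* The hypothesis multiplied by 2 mu; as q^L = n, it says that n x < 1. *)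
have L_lt : L < 2 * M * eps.
  by rewrite mulrC -ltr_pdivrMr ?mulr_gt0 // -subr_gt0.
have eps_gt0 : 0 < eps.
  by have := le_lt_trans L_ge0 L_lt; rewrite pmulr_rgt0 ?mulr_gt0.
have qD r s : q%:R `^ (r + s) = q%:R `^ r * q%:R `^ s :> R.
  by rewrite powRD // (gt_eqF q_gt0) implybT.
have nx_le1 : n%:R * x <= 1.
  rewrite -qL -qD -[leRHS](powRr0 q%:R); apply: ler_powR; last by lra.
  by rewrite ler1n ltnW.
have count : #|codesD_le F gT delta|%:R <= #|light_multipliers F cG delta|%:R :> R.
  by rewrite ler_nat; apply: codesD_le_light.
apply: le_trans count _.
have bound := card_light_multipliers_bound cG n_gt1 cnq d_ge0 d_le eps_gt0 nx_le1.
apply: le_trans bound _.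
(* Of the two factors q^L = n, one joins [x] and the other absorbs the 3; q^(7/2) absorbs the 9. *)
rewrite (_ : _ + 4 = n%:R * 2^-1 + (- (2 * M * eps)) + L + L + 7 / 2); last first.
  by rewrite /eps; field; rewrite gt_eqF.
rewrite !qD qL -/x powRrM powR_mulrn ?(ltW q_gt0) // -natrX -!mulrA.
rewrite ler_wpM2l ?powR_ge0 //.
(* Squared, this is 81 <= q^7, and already 2^7 = 128. *)
have q72 : 9 <= q%:R `^ (7 / 2) :> R.
  rewrite -(@ler_pXn2r _ 2) ?nnegrE ?powR_ge0 // -[leRHS]powR_mulrn ?powR_ge0 //.
  rewrite -powRrM divfK ?pnatr_eq0 // (powR_mulrn 7) ?(ltW q_gt0) // -!natrX ler_nat.
  by apply: (@leq_trans (2 ^ 7)); rewrite ?leq_exp2r.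
have x_ge0 : 0 <= x by rewrite powR_ge0.
rewrite (_ : 3 * _ = n%:R * x * (3 * 9)); last by ring.
rewrite (_ : x * _ = n%:R * x * (n%:R * q%:R `^ (7 / 2))); last by ring.
rewrite ler_wpM2l ?mulr_ge0 // ?(ltW n_gt0) // ler_pM // (ler_nat _ 3) //.
Qed.
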